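(* Let $\widetilde{\mathcal{F}}$ denote the distorted Fourier transform associated with the Schr\''odinger operator $H=-\partial_x^2-6\,\mathrm{sech}^2(x)$ on $\mathbb{R}$, let $Q(x)=\sqrt{2}\,\mathrm{sech}(x)$ and $Y_2(x)=1-\tfrac32\mathrm{sech}^2(x)$. Then $$\widetilde{\mathcal{F}}\bigl[3QY_2^2\bigr](\pm\sqrt{3})=\frac{3}{28}\,(1-3i\sqrt{3})\,\sqrt{\pi}\,\mathrm{sech}\Bigl(\frac{\pi\sqrt{3}}{2}\Bigr)\neq 0.$$
   Context: Conventions for the distorted Fourier transform: for $\xi\in\mathbb{R}$ let $f_\pm(x,\xi)$ be the Jost solutions, i.e. the solutions of $Hf_\pm(\cdot,\xi)=\xi^2f_\pm(\cdot,\xi)$ normalized by $e^{\mp ix\xi}f_\pm(x,\xi)\to1$ as $x\to\pm\infty$. The transmission coefficient $T(\xi)$ is determined by $T(\xi)\,W(f_+(\cdot,\xi),f_-(\cdot,\xi))=-2i\xi$, where $W(f,g)=fg'-f'g$ (extended continuously to $\xi=0$). The distorted Fourier basis is $e(x,\xi)=(2\pi)^{-1/2}T(\xi)f_+(x,\xi)$ for $\xi\geq0$ and $e(x,\xi)=(2\pi)^{-1/2}T(-\xi)f_-(x,-\xi)$ for $\xi<0$, and $\widetilde{\mathcal{F}}[g](\xi)=\int_{\mathbb{R}}\overline{e(x,\xi)}\,g(x)\,dx$. ($Y_2$ is the even threshold resonance: $HY_2=0$.) *)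

(* Defs.v *)
From Stdlib Require Import Reals ClassicalEpsilon.
From Coquelicot Require Import Coquelicot.
Open Scope R_scope.

Definition sech (x : R) : R := / cosh x.

Definition Q (x : R) : R := sqrt 2 * sech x.

Definition Y2 (x : R) : R := 1 - 3 / 2 * sech x ^ 2.

(* exp (i t) for real t *)
Definition expi (t : R) : C := (cos t, sin t).

(* Coquelicot's total [Derive] is only real-valued, so complex-valued functions
   of a real variable are differentiated componentwise. *)
Definition CDerive (f : R -> C) (x : R) : C :=
  (Derive (fun t => Re (f t)) x, Derive (fun t => Im (f t)) x).

Definition twice_differentiable (f : R -> C) : Prop :=
  (forall x, ex_derive (K := R_AbsRing) (V := C_R_NormedModule) f x) /\
  (forall x, ex_derive (K := R_AbsRing) (V := C_R_NormedModule) (CDerive f) x).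

(* H = - d^2/dx^2 - 6 sech^2 *)
Definition H (f : R -> C) (x : R) : C :=
  (- CDerive (CDerive f) x - RtoC (6 * sech x ^ 2) * f x)%C.

Definition is_eigensolution (xi : R) (f : R -> C) : Prop :=
  twice_differentiable f /\ forall x, H f x = (RtoC (xi ^ 2) * f x)%C.

Definition is_jost_plus (xi : R) (f : R -> C) : Prop :=
  is_eigensolution xi f /\
  filterlim (fun x => (expi (- (x * xi)) * f x)%C)
    (Rbar_locally p_infty) (@locally C_UniformSpace (RtoC 1)).

Definition is_jost_minus (xi : R) (f : R -> C) : Prop :=
  is_eigensolution xi f /\
  filterlim (fun x => (expi (x * xi) * f x)%C)
    (Rbar_locally m_infty) (@locally C_UniformSpace (RtoC 1)).

(* For every real xi the solution with the prescribed asymptotics exists and is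
   unique, so the choice operator below denotes it. *)
Definition f_plus (xi : R) : R -> C :=
  epsilon (inhabits (fun _ : R => RtoC 0)) (is_jost_plus xi).

Definition f_minus (xi : R) : R -> C :=
  epsilon (inhabits (fun _ : R => RtoC 0)) (is_jost_minus xi).

Definition W (f g : R -> C) (x : R) : C :=
  (f x * CDerive g x - CDerive f x * g x)%C.

(* The Wronskian of two solutions does not depend on x; it is nonzero for
   xi <> 0 but vanishes at xi = 0 (threshold resonance), where T is determined
   by continuity instead. *)
Definition is_transmission (T : R -> C) : Prop :=
  (forall xi x, xi <> 0 ->
     (T xi * W (f_plus xi) (f_minus xi) x)%C = (- (2 * Ci * RtoC xi))%C) /\
  continuous (U := C_UniformSpace) T 0.

Definition T : R -> C :=
  epsilon (inhabits (fun _ : R => RtoC 0)) is_transmission.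

Definition e (x xi : R) : C :=
  if Rle_dec 0 xi
  then (RtoC (/ sqrt (2 * PI)) * T xi * f_plus xi x)%C
  else (RtoC (/ sqrt (2 * PI)) * T (- xi) * f_minus (- xi) x)%C.

(* [RInt_gen] is total; [dFT_converges] asserts that the integral over R
   actually converges, its two ends being independent. *)
Definition dFT_converges (g : R -> C) (xi : R) : Prop :=
  ex_RInt_gen (V := C_R_NormedModule) (fun x => (Cconj (e x xi) * g x)%C)
    (Rbar_locally m_infty) (Rbar_locally p_infty).

Definition dFT (g : R -> C) (xi : R) : C :=
  RInt_gen (V := C_R_CompleteNormedModule) (fun x => (Cconj (e x xi) * g x)%C)
    (Rbar_locally m_infty) (Rbar_locally p_infty).

(* Main.v *)
(* On the line, [f_+(x, xi) = e^(i x xi) (3 tanh^2 x - 1 - xi^2 - 3 i xi tanh x)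
   / ((1 - i xi) (2 - i xi))] and [f_-(x, xi) = f_+(-x, xi)].  For [xi <> 0] uniqueness holds
   because two Jost solutions differ by a solution tending to [0], while every nonzero
   solution is asymptotic to a nonzero sinusoid.  Hence
   [T(xi) = (1 - i xi) (2 - i xi) / ((1 + i xi) (2 + i xi))].

   The source being even, only the even part of the conjugated basis function contributes.
   For [xi^2 = 3], modulo the derivative of an explicit decaying function, its
   product with the source is a constant multiple of [sech x cos (xi x)], so everything reduces to
   [int_R sech x cos (xi x) dx = PI sech (PI xi / 2)].

   For that integral, expand [sech x = 2 sum_n (-1)^n e^(-(2n+1) x)] on the half line, which
   gives [int_0^oo sech x cos (xi x) dx = 2 sum_n (-1)^n m / (m^2 + xi^2)] with [m = 2n + 1].
   Since [int_0^(PI/2) cosh (xi x) cos (m x) dx = (-1)^n m cosh (xi PI/2) / (m^2 + xi^2)],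
   localization of the Dirichlet kernel at [0] shows that [cosh (xi PI/2)] times this series
   has the same sum as the series at [xi = 0], which is Leibniz's series for [PI / 4]. *)

Require Import Defs.
From Stdlib Require Import Reals Lra Lia FunctionalExtensionality ClassicalEpsilon.
From Coquelicot Require Import Coquelicot.
Open Scope R_scope.

Lemma is_derive_dominated (f g df dg : R -> R) (a b : R) :
  a <= b ->
  (forall x, a <= x <= b -> is_derive f x (df x)) ->
  (forall x, a <= x <= b -> is_derive g x (dg x)) ->
  (forall x, a <= x <= b -> Rabs (df x) <= dg x) ->
  Rabs (f b - f a) <= g b - g a.
Proof.
  intros Hab Hf Hg Hd.
  assert (E : Rmin a b = a) by (apply Rmin_left; lra).
  assert (E' : Rmax a b = b) by (apply Rmax_right; lra).
  destruct (MVT_gen (fun x => g x - f x) a b (fun x => dg x - df x)) as [c [Hc Ec]].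
  - intros x Hx; rewrite E, E' in Hx.
    apply @is_derive_minus; [apply Hg | apply Hf]; lra.
  - intros x Hx; rewrite E, E' in Hx.
    apply derivable_continuous_pt; exists (dg x - df x); apply is_derive_Reals.
    apply @is_derive_minus; [apply Hg | apply Hf]; lra.
  - destruct (MVT_gen (fun x => g x + f x) a b (fun x => dg x + df x)) as [c' [Hc' Ec']].
    + intros x Hx; rewrite E, E' in Hx.
      apply @is_derive_plus; [apply Hg | apply Hf]; lra.
    + intros x Hx; rewrite E, E' in Hx.
      apply derivable_continuous_pt; exists (dg x + df x); apply is_derive_Reals.
      apply @is_derive_plus; [apply Hg | apply Hf]; lra.
    + rewrite E, E' in Hc, Hc'.
      assert (H1 := Hd c Hc). assert (H2 := Hd c' Hc').
      apply Rabs_le_between in H1. apply Rabs_le_between in H2.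
      apply Rabs_le_between. simpl in Ec, Ec'.
      assert (0 <= (dg c - df c) * (b - a)) by (apply Rmult_le_pos; lra).
      assert (0 <= (dg c' + df c') * (b - a)) by (apply Rmult_le_pos; lra).
      lra.
Qed.

Lemma cosh_pos (x : R) : 0 < cosh x.
Proof.
  unfold cosh. assert (H1 := exp_pos x). assert (H2 := exp_pos (- x)). lra.
Qed.

Lemma is_derive_cosh (x : R) : is_derive cosh x (sinh x).
Proof. apply is_derive_Reals, derivable_pt_lim_cosh. Qed.

Lemma is_derive_sinh (x : R) : is_derive sinh x (cosh x).
Proof. apply is_derive_Reals, derivable_pt_lim_sinh. Qed.

Lemma cosh_opp (x : R) : cosh (- x) = cosh x.
Proof. unfold cosh. rewrite Ropp_involutive. lra. Qed.

Lemma sinh_opp (x : R) : sinh (- x) = - sinh x.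
Proof. unfold sinh. rewrite Ropp_involutive. lra. Qed.

Lemma cosh_sqr (x : R) : cosh x ^ 2 = 1 + sinh x ^ 2.
Proof.
  unfold cosh, sinh.
  assert (E : exp x * exp (- x) = 1) by (rewrite <- exp_plus, Rplus_opp_r; apply exp_0).
  nra.
Qed.

Lemma sech_pos (x : R) : 0 < sech x.
Proof. apply Rinv_0_lt_compat, cosh_pos. Qed.

Lemma sech_opp (x : R) : sech (- x) = sech x.
Proof. unfold sech. now rewrite cosh_opp. Qed.

Lemma tanh_opp (x : R) : tanh (- x) = - tanh x.
Proof. unfold tanh. rewrite cosh_opp, sinh_opp. unfold Rdiv. ring. Qed.

Lemma tanh_sqr (x : R) : tanh x ^ 2 = 1 - sech x ^ 2.
Proof.
  unfold tanh, sech. assert (Hc := cosh_pos x). assert (E := cosh_sqr x).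
  replace (sinh x) with (sinh x * 1) by ring.
  apply Rmult_eq_reg_r with (cosh x ^ 2); [ | apply pow_nonzero; lra].
  field_simplify; lra.
Qed.

Lemma is_derive_sech (x : R) : is_derive sech x (- (sech x * tanh x)).
Proof.
  assert (Hc := cosh_pos x).
  replace (- (sech x * tanh x)) with (- sinh x / cosh x ^ 2)
    by (unfold sech, tanh; field; lra).
  apply is_derive_inv; [apply is_derive_cosh | lra].
Qed.

Lemma is_derive_tanh (x : R) : is_derive tanh x (sech x ^ 2).
Proof.
  assert (Hc := cosh_pos x). assert (E := cosh_sqr x).
  replace (sech x ^ 2) with ((cosh x * cosh x - sinh x * sinh x) / cosh x ^ 2).
  - apply (is_derive_div sinh cosh);
      [apply is_derive_sinh | apply is_derive_cosh | lra].
  - replace (cosh x * cosh x - sinh x * sinh x) with 1 by lra.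
    unfold sech; field; lra.
Qed.

Lemma sech_le_exp (x : R) : sech x <= 2 * exp (- x).
Proof.
  unfold sech. apply Rmult_le_reg_r with (cosh x); [apply cosh_pos | ].
  rewrite Rinv_l by (assert (Hc := cosh_pos x); lra).
  unfold cosh.
  assert (E : exp x * exp (- x) = 1) by (rewrite <- exp_plus, Rplus_opp_r; apply exp_0).
  assert (H2 := exp_pos (- x)). nra.
Qed.

Lemma sech_le_1 (x : R) : sech x <= 1.
Proof.
  unfold sech. rewrite <- Rinv_1. apply Rinv_le_contravar; [lra | ].
  assert (E := cosh_sqr x). assert (Hc := cosh_pos x). nra.
Qed.

Lemma is_derive_sum_f_R0 (u du : nat -> R -> R) (N : nat) (x : R) :
  (forall n, is_derive (u n) x (du n x)) ->
  is_derive (fun y => sum_f_R0 (fun n => u n y) N) x (sum_f_R0 (fun n => du n x) N).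
Proof.
  intros Hu. induction N as [ | N IH]; simpl; [apply Hu | ].
  now apply @is_derive_plus.
Qed.

(** * The cosine transform of sech *)

Definition odd_freq (n : nat) : R := INR (2 * n + 1).

Lemma odd_freq_INR (n : nat) : odd_freq n = 2 * INR n + 1.
Proof. unfold odd_freq. rewrite plus_INR, mult_INR. simpl. ring. Qed.

Lemma odd_freq_S (n : nat) : odd_freq (S n) = odd_freq n + 2.
Proof. rewrite !odd_freq_INR, S_INR. ring. Qed.

Lemma odd_freq_pos (n : nat) : 0 < odd_freq n.
Proof. apply lt_0_INR. lia. Qed.

Lemma sum_cos_odd (N : nat) (x : R) :
  2 * sin x * sum_f_R0 (fun n => cos (odd_freq n * x)) N = sin (2 * INR (S N) * x).
Proof.
  induction N as [ | N IH].
  - simpl. rewrite odd_freq_INR. simpl.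
    replace ((2 * 0 + 1) * x) with x by ring. replace (2 * 1 * x) with (2 * x) by ring.
    rewrite sin_2a. ring.
  - simpl sum_f_R0. rewrite Rmult_plus_distr_l, IH, odd_freq_INR.
    rewrite (S_INR (S N)).
    replace (2 * INR (S N) * x) with ((2 * INR (S N) + 1) * x - x) by ring.
    replace (2 * (INR (S N) + 1) * x) with ((2 * INR (S N) + 1) * x + x) by ring.
    rewrite sin_minus, sin_plus. ring.
Qed.

Lemma sin_odd_freq_PI2 (n : nat) : sin (odd_freq n * (PI / 2)) = (-1) ^ n.
Proof.
  induction n as [ | n IH].
  - rewrite odd_freq_INR. simpl. replace ((2 * 0 + 1) * (PI / 2)) with (PI / 2) by ring.
    apply sin_PI2.
  - rewrite odd_freq_S. replace ((odd_freq n + 2) * (PI / 2)) with (odd_freq n * (PI / 2) + PI) by field.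
    rewrite neg_sin, IH. simpl. ring.
Qed.

Lemma cos_odd_freq_PI2 (n : nat) : cos (odd_freq n * (PI / 2)) = 0.
Proof.
  assert (E := sin2_cos2 (odd_freq n * (PI / 2))).
  rewrite sin_odd_freq_PI2 in E. unfold Rsqr in E.
  rewrite <- Rpow_mult_distr in E.
  replace (-1 * -1) with 1 in E by ring. rewrite pow1 in E.
  nra.
Qed.

(* [int_x^(pi/2) sin (2 (N + 1) s) / sin s ds], integrated term by term. *)
Definition dirichlet_tail (N : nat) (x : R) : R :=
  2 * sum_f_R0 (fun n => ((-1) ^ n - sin (odd_freq n * x)) / odd_freq n) N.

Lemma is_derive_dirichlet_tail (N : nat) (x : R) :
  is_derive (dirichlet_tail N) x (- 2 * sum_f_R0 (fun n => cos (odd_freq n * x)) N).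
Proof.
  replace (- 2 * sum_f_R0 (fun n => cos (odd_freq n * x)) N)
    with (2 * sum_f_R0 (fun n => - cos (odd_freq n * x)) N).
  - apply is_derive_scal.
    apply (is_derive_sum_f_R0 (fun n y => ((-1) ^ n - sin (odd_freq n * y)) / odd_freq n)
             (fun n y => - cos (odd_freq n * y))).
    intros n. assert (Hn := odd_freq_pos n). auto_derive; [trivial | field; lra].
  - rewrite <- (sum_eq (fun n => cos (odd_freq n * x) * -1)) by (intros; ring).
    rewrite <- scal_sum. ring.
Qed.

Lemma dirichlet_tail_PI2 (N : nat) : dirichlet_tail N (PI / 2) = 0.
Proof.
  unfold dirichlet_tail.
  rewrite (sum_eq _ (fun _ => 0)).
  - rewrite sum_cte. ring.
  - intros n _. rewrite sin_odd_freq_PI2. unfold Rdiv. ring.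
Qed.

Lemma Rabs_cos_le_1 (x : R) : Rabs (cos x) <= 1.
Proof. apply Rabs_le_between, COS_bound. Qed.

Lemma Rabs_sin_le_1 (x : R) : Rabs (sin x) <= 1.
Proof. apply Rabs_le_between, SIN_bound. Qed.

(* One integration by parts against [cos (2 (N + 1) x) / (2 (N + 1))]. *)
Lemma dirichlet_tail_bound (N : nat) (x : R) :
  0 < x <= PI / 2 -> Rabs (dirichlet_tail N x) <= / (INR (S N) * sin x).
Proof.
  intros Hx. assert (HPI := PI_RGT_0).
  assert (HM : 0 < INR (S N)) by (apply lt_0_INR; lia).
  set (M := INR (S N)) in *.
  assert (Hs : 0 < sin x) by (apply sin_gt_0; lra).
  assert (B := is_derive_dominated
    (fun y => dirichlet_tail N y - cos (2 * M * y) / (2 * M * sin y))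
    (fun y => - / (2 * M * sin y))
    (fun y => cos (2 * M * y) * cos y / (2 * M * sin y ^ 2))
    (fun y => cos y / (2 * M * sin y ^ 2)) x (PI / 2)).
  cbv beta in B. rewrite dirichlet_tail_PI2, sin_PI2 in B.
  assert (B' : Rabs (0 - cos (2 * M * (PI / 2)) / (2 * M * 1) -
      (dirichlet_tail N x - cos (2 * M * x) / (2 * M * sin x))) <=
      - / (2 * M * 1) - - / (2 * M * sin x)).
  { apply B; [lra | | | ].
    - intros y Hy. assert (Hsy : 0 < sin y) by (apply sin_gt_0; lra).
      replace (cos (2 * M * y) * cos y / (2 * M * sin y ^ 2)) with
        (- 2 * sum_f_R0 (fun n => cos (odd_freq n * y)) N -
         (- (sin (2 * M * y) / sin y)
          - cos (2 * M * y) * cos y / (2 * M * sin y ^ 2))).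
      + apply @is_derive_minus; [apply is_derive_dirichlet_tail | ].
        auto_derive; [apply Rmult_integral_contrapositive; split; lra | field; lra].
      + unfold M. rewrite <- (sum_cos_odd N y). fold M. field. lra.
    - intros y Hy. assert (Hsy : 0 < sin y) by (apply sin_gt_0; lra).
      auto_derive; [apply Rmult_integral_contrapositive; split; lra | field; lra].
    - intros y Hy. assert (Hsy : 0 < sin y) by (apply sin_gt_0; lra).
      assert (Hcy : 0 <= cos y) by (apply cos_ge_0; lra).
      assert (Hd : 0 <= cos y / (2 * M * sin y ^ 2)).
      { apply Rdiv_le_0_compat; [easy | ].
        apply Rmult_lt_0_compat; [lra | now apply pow_lt]. }
      replace (cos (2 * M * y) * cos y / (2 * M * sin y ^ 2))
        with (cos (2 * M * y) * (cos y / (2 * M * sin y ^ 2)))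
        by (field; lra).
      rewrite Rabs_mult, (Rabs_right (cos y / _)) by lra.
      assert (Hc := Rabs_cos_le_1 (2 * M * y)). nra. }
  assert (Hc : forall y z, 0 < z -> Rabs (cos y / (2 * M * z)) <= / (2 * M * z)).
  { intros y z Hz. assert (0 < / (2 * M * z)).
    { apply Rinv_0_lt_compat, Rmult_lt_0_compat; lra. }
    unfold Rdiv. rewrite Rabs_mult, (Rabs_right (/ _)) by lra.
    assert (H1 := Rabs_cos_le_1 y). nra. }
  assert (C1 := Hc (2 * M * (PI / 2)) 1 ltac:(lra)).
  assert (C2 := Hc (2 * M * x) (sin x) Hs).
  replace (/ (M * sin x)) with (/ (2 * M * sin x) + / (2 * M * sin x)) by (field; lra).
  revert B' C1 C2. unfold Rabs. repeat destruct Rcase_abs; lra.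
Qed.

Lemma sin_ge_half (x : R) : 0 <= x <= PI / 2 -> x / 2 <= sin x.
Proof.
  intros Hx. assert (HPI := PI_RGT_0).
  assert (Hy : x / 2 * cos (x / 2) <= sin (x / 2)).
  { destruct (MVT_gen sin 0 (x / 2) cos) as [c [Hc E]].
    - intros y _. apply is_derive_sin.
    - intros y _. apply continuity_sin.
    - rewrite Rmin_left, Rmax_right in Hc by lra.
      rewrite sin_0, !Rminus_0_r in E. rewrite E.
      assert (cos (x / 2) <= cos c) by (apply cos_decr_1; lra).
      nra. }
  assert (Hc : 0 <= cos (x / 2)) by (apply cos_ge_0; lra).
  assert (E := sin_2a (x / 2)). assert (E' := cos_2a_cos (x / 2)).
  replace (2 * (x / 2)) with x in E, E' by field.
  assert (0 <= cos x) by (apply cos_ge_0; lra).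
  assert (x * (cos (x / 2) * cos (x / 2)) <= sin x) by nra.
  nra.
Qed.

Lemma sinh_le (x b : R) : 0 <= x <= b -> 0 <= sinh x <= x * cosh b.
Proof.
  intros Hx.
  assert (Hm : forall u v, 0 <= u <= v -> cosh u <= cosh v).
  { intros u v Huv. unfold cosh.
    rewrite 2!exp_Ropp.
    assert (E : exp v = exp u * exp (v - u)) by (rewrite <- exp_plus; f_equal; ring).
    assert (H1 : 1 <= exp u).
    { rewrite <- exp_0. destruct (Req_dec u 0) as [-> | Hu]; [lra | ].
      apply Rlt_le, exp_increasing. lra. }
    assert (H2 : exp u <= exp v).
    { destruct (Req_dec u v) as [-> | Hu]; [lra | ].
      apply Rlt_le, exp_increasing. lra. }
    assert (E' : exp v + / exp v - (exp u + / exp u)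
                 = (exp v - exp u) * (1 - / (exp u * exp v))) by (field; lra).
    assert (/ (exp u * exp v) <= 1).
    { rewrite <- Rinv_1. apply Rinv_le_contravar; nra. }
    nra. }
  destruct (MVT_gen sinh 0 x cosh) as [c [Hc E]].
  - intros y _. apply is_derive_sinh.
  - intros y _. apply derivable_continuous_pt, derivable_pt_sinh.
  - rewrite Rmin_left, Rmax_right in Hc by lra.
    rewrite sinh_0, !Rminus_0_r in E. rewrite E.
    assert (H1 := cosh_pos c). assert (H2 := Hm c b ltac:(lra)). nra.
Qed.

Definition alt_poisson_sum (xi : R) (N : nat) : R :=
  sum_f_R0 (fun n => (-1) ^ n * (odd_freq n / (odd_freq n ^ 2 + xi ^ 2))) N.

Lemma poisson_denominator_pos (xi : R) (n : nat) : 0 < odd_freq n ^ 2 + xi ^ 2.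
Proof.
  assert (Hn := odd_freq_pos n). assert (H1 := pow2_ge_0 xi).
  assert (0 < odd_freq n ^ 2) by now apply pow_lt. lra.
Qed.

Lemma alt_poisson_sum_leibniz (xi : R) :
  0 <= xi ->
  exists K, forall N,
    Rabs (2 * cosh (xi * (PI / 2)) * alt_poisson_sum xi N
          - 2 * sum_f_R0 (fun n => (-1) ^ n * / odd_freq n) N) <= K / INR (S N).
Proof.
  intros Hxi. assert (HPI := PI_RGT_0).
  set (K := 2 * xi ^ 2 * cosh (xi * (PI / 2))).
  exists (K * (PI / 2)). intros N.
  assert (HM : 0 < INR (S N)) by (apply lt_0_INR; lia).
  assert (HK : 0 <= K).
  { unfold K. assert (H1 := pow2_ge_0 xi). assert (H2 := cosh_pos (xi * (PI / 2))). nra. }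
  assert (Hn := odd_freq_pos). assert (Hd := poisson_denominator_pos xi).
  set (Theta := fun x =>
    2 * sum_f_R0 (fun n => (xi * sinh (xi * x) * cos (odd_freq n * x)
                   + odd_freq n * cosh (xi * x) * sin (odd_freq n * x))
                  / (odd_freq n ^ 2 + xi ^ 2)) N
    + cosh (xi * x) * dirichlet_tail N x).
  assert (DT : forall x, is_derive Theta x (xi * sinh (xi * x) * dirichlet_tail N x)).
  { intros x. unfold Theta.
    assert (Dc : is_derive (fun y => cosh (xi * y)) x (xi * sinh (xi * x))).
    { auto_derive; [trivial | ring]. }
    replace (xi * sinh (xi * x) * dirichlet_tail N x) with
      (2 * sum_f_R0 (fun n => cosh (xi * x) * cos (odd_freq n * x)) N
       + (xi * sinh (xi * x) * dirichlet_tail N x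
          + cosh (xi * x) * (- 2 * sum_f_R0 (fun n => cos (odd_freq n * x)) N))).
    - apply @is_derive_plus.
      + apply is_derive_scal.
        apply (is_derive_sum_f_R0 (fun n y =>
          (xi * sinh (xi * y) * cos (odd_freq n * y)
           + odd_freq n * cosh (xi * y) * sin (odd_freq n * y))
            / (odd_freq n ^ 2 + xi ^ 2)) (fun n y => cosh (xi * y) * cos (odd_freq n * y))).
        intros n. specialize (Hd n).
        auto_derive; [trivial | field; lra].
      + apply (is_derive_mult (fun y => cosh (xi * y)) (dirichlet_tail N));
          [apply Dc | apply is_derive_dirichlet_tail | intros; apply Rmult_comm].
    - rewrite <- (sum_eq (fun n => cos (odd_freq n * x) * cosh (xi * x)))
        by (intros; ring).
      rewrite <- scal_sum. ring. }
  assert (B := is_derive_dominated Theta (fun x => K / INR (S N) * x)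
    (fun x => xi * sinh (xi * x) * dirichlet_tail N x)
    (fun _ => K / INR (S N)) 0 (PI / 2)).
  replace (2 * cosh (xi * (PI / 2)) * alt_poisson_sum xi N) with (Theta (PI / 2)).
  - replace (2 * sum_f_R0 (fun n => (-1) ^ n * / odd_freq n) N) with (Theta 0).
    + replace (K * (PI / 2) / INR (S N)) with
        (K / INR (S N) * (PI / 2) - K / INR (S N) * 0) by (field; lra).
      apply B; [lra | now intros | | ].
      { intros x _. set (q := K / INR (S N)). auto_derive; [trivial | ring]. }
      intros x Hx.
      destruct (Req_dec x 0) as [-> | Hx0].
      { rewrite Rmult_0_r, sinh_0, Rmult_0_r, Rmult_0_l, Rabs_R0.
        apply Rdiv_le_0_compat; lra. }
      assert (B1 := dirichlet_tail_bound N x ltac:(lra)).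
      assert (B2 := sin_ge_half x ltac:(lra)).
      assert (B3 := sinh_le (xi * x) (xi * (PI / 2)) ltac:(split; nra)).
      assert (B4 : / (INR (S N) * sin x) <= 2 / (INR (S N) * x)).
      { replace (2 / (INR (S N) * x)) with (/ (INR (S N) * (x / 2))) by (field; lra).
        apply Rinv_le_contravar; [apply Rmult_lt_0_compat; lra | ].
        apply Rmult_le_compat_l; lra. }
      rewrite 2!Rabs_mult, (Rabs_right xi), (Rabs_right (sinh _)) by lra.
      replace (K / INR (S N)) with
        (xi * (xi * x * cosh (xi * (PI / 2))) * (2 / (INR (S N) * x)))
        by (unfold K; field; lra).
      apply Rmult_le_compat; [nra | apply Rabs_pos | nra | lra].
    + unfold Theta. rewrite Rmult_0_r, cosh_0, sinh_0.
      rewrite (sum_eq _ (fun _ => 0)).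
      * rewrite sum_cte. unfold dirichlet_tail.
        rewrite (sum_eq (fun n => ((-1) ^ n - sin (odd_freq n * 0)) / odd_freq n)
                  (fun n => (-1) ^ n * / odd_freq n)); [ring | ].
        intros n _. rewrite Rmult_0_r, sin_0. unfold Rdiv. ring.
      * intros n _. rewrite !Rmult_0_r, sin_0. unfold Rdiv. ring.
  - unfold Theta. rewrite dirichlet_tail_PI2. unfold alt_poisson_sum.
    rewrite (sum_eq _ (fun n => (-1) ^ n * (odd_freq n / (odd_freq n ^ 2 + xi ^ 2))
                                * cosh (xi * (PI / 2)))).
    + rewrite <- scal_sum. ring.
    + intros n _. rewrite sin_odd_freq_PI2, cos_odd_freq_PI2. field.
      specialize (Hd n). lra.
Qed.

Lemma alt_poisson_sum_lim (xi : R) :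
  0 <= xi ->
  is_lim_seq (fun k => alt_poisson_sum xi (2 * k)) (PI / (4 * cosh (xi * (PI / 2)))).
Proof.
  intros Hxi. assert (Hc := cosh_pos (xi * (PI / 2))). set (c := cosh (xi * (PI / 2))) in *.
  destruct (alt_poisson_sum_leibniz xi Hxi) as [K HK]. fold c in HK.
  assert (HK0 : 0 <= K).
  { assert (B := HK 0%nat). assert (B' := Rle_trans _ _ _ (Rabs_pos _) B).
    change (INR 1) with 1 in B'. lra. }
  assert (L : is_lim_seq (fun k => (K + 2) / (2 * c) * / INR (S k)) 0).
  { replace (Finite 0) with (Rbar_mult ((K + 2) / (2 * c)) 0) by (simpl; f_equal; ring).
    apply is_lim_seq_scal_l.
    apply (is_lim_seq_incr_1 (fun k => / INR k)).
    replace (Finite 0) with (Rbar_inv p_infty) by easy.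
    apply is_lim_seq_inv; [apply is_lim_seq_INR | easy]. }
  apply is_lim_seq_ext with (fun k => PI / (4 * c) + (alt_poisson_sum xi (2 * k) - PI / (4 * c)));
    [intros; ring | ].
  replace (Finite (PI / (4 * c))) with (Finite (PI / (4 * c) + 0)) by (f_equal; ring).
  apply is_lim_seq_plus'; [apply is_lim_seq_const | ].
  apply is_lim_seq_abs_0.
  apply (is_lim_seq_le_le (fun _ => 0) _ (fun k => (K + 2) / (2 * c) * / INR (S k)));
    [ | apply is_lim_seq_const | exact L].
  intros k. split; [apply Rabs_pos | ].
  specialize (HK (2 * k)%nat).
  assert (P : Rabs (2 * sum_f_R0 (fun n => (-1) ^ n * / odd_freq n) (2 * k) - PI / 2)
              <= 2 / INR (S k)).
  { destruct (PI_ineq k) as [P1 P2].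
    change (sum_f_R0 (tg_alt PI_tg) (2 * k)) with
      (sum_f_R0 (fun n => (-1) ^ n * / odd_freq n) (2 * k)) in P2.
    change (sum_f_R0 (tg_alt PI_tg) (S (2 * k))) with
      (sum_f_R0 (fun n => (-1) ^ n * / odd_freq n) (2 * k)
       + (-1) ^ S (2 * k) * / odd_freq (S (2 * k))) in P1.
    rewrite pow_1_odd in P1.
    assert (/ odd_freq (S (2 * k)) <= / INR (S k)).
    { apply Rinv_le_contravar; [apply lt_0_INR; lia | apply le_INR; lia]. }
    apply Rabs_le_between. unfold Rdiv. lra. }
  assert (B : K / INR (S (2 * k)) <= K / INR (S k)).
  { apply Rmult_le_compat_l; [easy | ].
    apply Rinv_le_contravar; [apply lt_0_INR; lia | apply le_INR; lia]. }
  replace (alt_poisson_sum xi (2 * k) - PI / (4 * c)) with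
    (/ (2 * c) * (2 * c * alt_poisson_sum xi (2 * k) - PI / 2)) by (field; lra).
  rewrite Rabs_mult, (Rabs_right (/ _)) by (apply Rle_ge, Rlt_le, Rinv_0_lt_compat; lra).
  replace ((K + 2) / (2 * c) * / INR (S k)) with (/ (2 * c) * (K / INR (S k) + 2 / INR (S k)))
    by (field; split; [apply not_0_INR; lia | lra]).
  apply Rmult_le_compat_l; [apply Rlt_le, Rinv_0_lt_compat; lra | ].
  revert HK P B. unfold Rabs. repeat destruct Rcase_abs; lra.
Qed.

Lemma sech_geometric_remainder (N : nat) (x : R) :
  Rabs (sech x / 2 - sum_f_R0 (fun n => (-1) ^ n * exp (- (odd_freq n * x))) N)
  <= exp (- (odd_freq (S N) * x)).
Proof.
  assert (Hx := exp_pos (- x)).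
  assert (E : exp x * exp (- x) = 1) by (rewrite <- exp_plus, Rplus_opp_r; apply exp_0).
  assert (Es : sech x / 2 = exp (- x) / (1 + exp (- x) ^ 2)).
  { unfold sech, cosh. rewrite exp_Ropp. assert (H1 := exp_pos x). field.
    assert (0 < exp x ^ 2) by (apply pow_lt; easy). repeat split; lra. }
  assert (Ee : forall n, exp (- (odd_freq (S n) * x)) = exp (- (odd_freq n * x)) * exp (- x) ^ 2).
  { intros n. rewrite odd_freq_S.
    replace (- ((odd_freq n + 2) * x)) with (- (odd_freq n * x) + (- x + - x)) by ring.
    rewrite 2!exp_plus. ring. }
  assert (Hq : 0 < 1 + exp (- x) ^ 2) by nra.
  assert (R : sech x / 2 - sum_f_R0 (fun n => (-1) ^ n * exp (- (odd_freq n * x))) N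
      = (-1) ^ S N * (exp (- (odd_freq (S N) * x)) / (1 + exp (- x) ^ 2))).
  { rewrite Es. induction N as [ | N IH].
    - simpl sum_f_R0. rewrite Ee, odd_freq_INR. simpl INR.
      replace (- ((2 * 0 + 1) * x)) with (- x) by ring. simpl. field. lra.
    - change (sum_f_R0 (fun n => (-1) ^ n * exp (- (odd_freq n * x))) (S N)) with
        (sum_f_R0 (fun n => (-1) ^ n * exp (- (odd_freq n * x))) N
         + (-1) ^ S N * exp (- (odd_freq (S N) * x))).
      rewrite (Ee (S N)).
      replace (exp (- x) / (1 + exp (- x) ^ 2)) with
        ((exp (- x) / (1 + exp (- x) ^ 2)
          - sum_f_R0 (fun n => (-1) ^ n * exp (- (odd_freq n * x))) N)
         + sum_f_R0 (fun n => (-1) ^ n * exp (- (odd_freq n * x))) N) by ring.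
      rewrite IH. simpl pow. field. lra. }
  rewrite R, Rabs_mult, pow_1_abs, Rmult_1_l.
  assert (H1 := exp_pos (- (odd_freq (S N) * x))).
  rewrite Rabs_right.
  - apply Rmult_le_reg_r with (1 + exp (- x) ^ 2); [easy | ].
    unfold Rdiv. rewrite Rmult_assoc, Rinv_l by lra. nra.
  - apply Rle_ge, Rlt_le, Rdiv_lt_0_compat; easy.
Qed.

Lemma continuous_of_derive (f : R -> R) (x l : R) : is_derive f x l -> continuous f x.
Proof. intros Hf. apply (ex_derive_continuous f). now exists l. Qed.

Lemma is_derive_primitive (f : R -> R) (x : R) :
  (forall y, continuous f y) -> is_derive (RInt f 0) x (f x).
Proof.
  intros Hf. apply (is_derive_RInt f (RInt f 0) 0); [ | apply Hf].
  apply filter_forall. intros y. apply (@RInt_correct R_CompleteNormedModule).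
  apply (@ex_RInt_continuous R_CompleteNormedModule). intros; apply Hf.
Qed.

Lemma continuous_sech_cos (xi x : R) : continuous (fun y => sech y * cos (xi * y)) x.
Proof.
  eapply continuous_of_derive.
  apply (is_derive_mult sech (fun y => cos (xi * y))).
  - apply is_derive_sech.
  - auto_derive; [trivial | reflexivity].
  - intros; apply Rmult_comm.
Qed.

Lemma is_lim_exp_neg (m : R) : 0 < m -> is_lim (fun x => exp (- (m * x))) p_infty 0.
Proof.
  intros Hm. apply is_lim_comp with m_infty.
  - apply is_lim_exp_m.
  - apply (is_lim_opp (fun x => m * x) p_infty p_infty).
    replace p_infty with (Rbar_mult m p_infty) at 2.
    + apply is_lim_scal_l, is_lim_id.
    + simpl. destruct Rle_dec as [H | H]; [ | lra].
      destruct Rle_lt_or_eq_dec; [easy | lra].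
  - apply filter_forall. intros; discriminate.
Qed.

Lemma is_lim_dominated_0 (f g : R -> R) (K : R) (l : Rbar) :
  (forall x, Rabs (f x) <= K * g x) -> is_lim g l 0 -> is_lim f l 0.
Proof.
  intros Hf Hg.
  apply is_lim_le_le_loc with (fun x => - (K * g x)) (fun x => K * g x).
  - apply filter_forall. intros x. now apply Rabs_le_between.
  - replace (Finite 0) with (Rbar_opp (Rbar_mult K 0)) by (simpl; f_equal; ring).
    now apply is_lim_opp, is_lim_scal_l.
  - replace (Finite 0) with (Rbar_mult K 0) by (simpl; f_equal; ring).
    now apply is_lim_scal_l.
Qed.

Definition laplace_cos (xi : R) (n : nat) (X : R) : R :=
  (odd_freq n + exp (- (odd_freq n * X)) * (xi * sin (xi * X) - odd_freq n * cos (xi * X)))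
  / (odd_freq n ^ 2 + xi ^ 2).

Lemma is_lim_laplace_cos (xi : R) (n : nat) :
  is_lim (laplace_cos xi n) p_infty (odd_freq n / (odd_freq n ^ 2 + xi ^ 2)).
Proof.
  assert (Hd := poisson_denominator_pos xi n). assert (Hn := odd_freq_pos n).
  set (d := odd_freq n ^ 2 + xi ^ 2) in *.
  apply is_lim_ext with (fun X => odd_freq n / d
    + exp (- (odd_freq n * X)) * (xi * sin (xi * X) - odd_freq n * cos (xi * X)) / d).
  { intros X. unfold laplace_cos. fold d. field. lra. }
  replace (Finite (odd_freq n / d)) with (Finite (odd_freq n / d + 0)) by (f_equal; ring).
  apply is_lim_plus'; [apply is_lim_const | ].
  apply is_lim_dominated_0 with (fun X => exp (- (odd_freq n * X)))
    ((Rabs xi + odd_freq n) / d); [ | now apply is_lim_exp_neg].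
  intros X. assert (He := exp_pos (- (odd_freq n * X))).
  unfold Rdiv. rewrite 2!Rabs_mult, (Rabs_right (exp _)), (Rabs_right (/ d)) by
    (apply Rle_ge, Rlt_le; try apply Rinv_0_lt_compat; easy).
  assert (Rabs (xi * sin (xi * X) - odd_freq n * cos (xi * X)) <= Rabs xi + odd_freq n).
  { eapply Rle_trans; [apply Rabs_triang | ].
    rewrite Rabs_Ropp, 2!Rabs_mult, (Rabs_right (odd_freq n)) by lra.
    assert (H1 := Rabs_cos_le_1 (xi * X)). assert (H2 := Rabs_sin_le_1 (xi * X)).
    assert (H3 := Rabs_pos xi). nra. }
  assert (Hi : 0 < / d) by now apply Rinv_0_lt_compat.
  assert (exp (- (odd_freq n * X)) * / d > 0) by (apply Rmult_lt_0_compat; easy).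
  nra.
Qed.

Lemma RInt_sech_cos_bound (xi : R) (N : nat) (X : R) :
  0 <= X ->
  Rabs (RInt (fun y => sech y * cos (xi * y)) 0 X / 2
        - sum_f_R0 (fun n => (-1) ^ n * laplace_cos xi n X) N) <= / odd_freq (S N).
Proof.
  intros HX. assert (Hm := odd_freq_pos (S N)). set (m := odd_freq (S N)) in *.
  assert (Hd := poisson_denominator_pos xi).
  set (U := RInt (fun y => sech y * cos (xi * y)) 0).
  assert (B := is_derive_dominated
    (fun X => U X / 2 - sum_f_R0 (fun n => (-1) ^ n * laplace_cos xi n X) N)
    (fun X => - / m * exp (- (m * X)))
    (fun X => sech X * cos (xi * X) / 2
       - sum_f_R0 (fun n => (-1) ^ n * (exp (- (odd_freq n * X)) * cos (xi * X))) N)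
    (fun X => exp (- (m * X))) 0 X HX).
  assert (Z : U 0 / 2 - sum_f_R0 (fun n => (-1) ^ n * laplace_cos xi n 0) N = 0).
  { rewrite (sum_eq _ (fun _ => 0)).
    - rewrite sum_cte. unfold U. rewrite RInt_point. unfold zero; simpl. field.
    - intros n _. unfold laplace_cos.
      rewrite !Rmult_0_r, Ropp_0, exp_0, sin_0, cos_0. field. specialize (Hd n). lra. }
  simpl in B. rewrite Z, Rminus_0_r in B. eapply Rle_trans; [apply B | ].
  - intros x _. apply @is_derive_minus.
    + apply is_derive_ext with (fun y => / 2 * U y); [intros; unfold Rdiv; apply Rmult_comm | ].
      replace (sech x * cos (xi * x) / 2) with (/ 2 * (sech x * cos (xi * x))) by field.
      apply is_derive_scal. apply (is_derive_primitive (fun y => sech y * cos (xi * y))).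
      intros; apply continuous_sech_cos.
    + apply (is_derive_sum_f_R0 (fun n y => (-1) ^ n * laplace_cos xi n y)
        (fun n y => (-1) ^ n * (exp (- (odd_freq n * y)) * cos (xi * y)))).
      intros n. apply is_derive_scal. unfold laplace_cos. specialize (Hd n).
      auto_derive; [trivial | field; lra].
  - intros x _. auto_derive; [trivial | field; lra].
  - intros x Hx.
    replace (sech x * cos (xi * x) / 2
      - sum_f_R0 (fun n => (-1) ^ n * (exp (- (odd_freq n * x)) * cos (xi * x))) N)
      with (cos (xi * x)
            * (sech x / 2 - sum_f_R0 (fun n => (-1) ^ n * exp (- (odd_freq n * x))) N)).
    + rewrite Rabs_mult. assert (B1 := sech_geometric_remainder N x). fold m in B1.
      assert (B2 := Rabs_cos_le_1 (xi * x)).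
      assert (H1 := Rabs_pos (cos (xi * x))).
      assert (H2 := Rabs_pos (sech x / 2
        - sum_f_R0 (fun n => (-1) ^ n * exp (- (odd_freq n * x))) N)). nra.
    + rewrite Rmult_minus_distr_l, scal_sum.
      rewrite (sum_eq _ (fun n => (-1) ^ n * (exp (- (odd_freq n * x)) * cos (xi * x))))
        by (intros; ring). field.
  - rewrite Rmult_0_r, Ropp_0, exp_0.
    assert (H1 := exp_pos (- (m * X))). assert (H2 := Rinv_0_lt_compat m Hm). nra.
Qed.

Lemma is_lim_sum_f_R0 (u : nat -> R -> R) (l : nat -> R) (p : Rbar) (N : nat) :
  (forall n, is_lim (u n) p (l n)) ->
  is_lim (fun x => sum_f_R0 (fun n => u n x) N) p (sum_f_R0 l N).
Proof.
  intros Hu. induction N as [ | N IH]; simpl; [apply Hu | ].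
  now apply is_lim_plus'.
Qed.

Lemma RInt_sech_cos_lim (xi : R) :
  0 <= xi ->
  is_lim (RInt (fun y => sech y * cos (xi * y)) 0) p_infty (PI / 2 * sech (xi * (PI / 2))).
Proof.
  intros Hxi. assert (Hc := cosh_pos (xi * (PI / 2))).
  set (U := RInt (fun y => sech y * cos (xi * y)) 0).
  apply is_lim_spec. intros eps. assert (Heps := cond_pos eps).
  assert (L := alt_poisson_sum_lim xi Hxi).
  apply is_lim_seq_spec in L.
  assert (He8 : 0 < eps / 8) by lra.
  destruct (L (mkposreal _ He8)) as [k0 Hk0]. cbn [pos] in Hk0.
  assert (L' : is_lim_seq (fun k => / INR (S k)) 0).
  { apply (is_lim_seq_incr_1 (fun k => / INR k)).
    replace (Finite 0) with (Rbar_inv p_infty) by easy.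
    apply is_lim_seq_inv; [apply is_lim_seq_INR | easy]. }
  apply is_lim_seq_spec in L'.
  destruct (L' (mkposreal _ He8)) as [k1 Hk1]. cbn [pos] in Hk1.
  set (k := Nat.max k0 k1).
  specialize (Hk0 k ltac:(lia)). specialize (Hk1 k ltac:(lia)).
  rewrite Rminus_0_r in Hk1.
  assert (B1 : / odd_freq (S (2 * k)) <= / INR (S k)).
  { apply Rinv_le_contravar; [apply lt_0_INR; lia | apply le_INR; lia]. }
  assert (P := is_lim_sum_f_R0 (fun n X => (-1) ^ n * laplace_cos xi n X)
    (fun n => (-1) ^ n * (odd_freq n / (odd_freq n ^ 2 + xi ^ 2))) p_infty (2 * k)
    (fun n => is_lim_scal_l _ _ _ _ (is_lim_laplace_cos xi n))).
  apply is_lim_spec in P. destruct (P (mkposreal _ He8)) as [X0 HX0]. cbn [pos] in HX0.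
  exists (Rmax 0 X0). intros X HX.
  specialize (HX0 X (Rle_lt_trans _ _ _ (Rmax_r _ _) HX)).
  assert (B2 := RInt_sech_cos_bound xi (2 * k) X
    (Rlt_le _ _ (Rle_lt_trans _ _ _ (Rmax_l _ _) HX))).
  fold U in B2. fold (alt_poisson_sum xi (2 * k)) in HX0.
  replace (PI / 2 * sech (xi * (PI / 2))) with (2 * (PI / (4 * cosh (xi * (PI / 2)))))
    by (unfold sech; field; lra).
  apply Rabs_lt_between in Hk0. apply Rabs_lt_between in Hk1.
  apply Rabs_lt_between in HX0. apply Rabs_le_between in B2.
  apply Rabs_lt_between. split; lra.
Qed.

(** * Improper integrals over the line *)

Lemma filterlim_C_pair {A : Type} {F : (A -> Prop) -> Prop} {FF : Filter F}
    (u v : A -> R) (a b : R) :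
  filterlim u F (locally a) -> filterlim v F (locally b) ->
  filterlim (fun x => (u x, v x)) F (@locally C_UniformSpace (a, b)).
Proof.
  intros Hu Hv P [eps HP].
  assert (Hu' := Hu _ (locally_ball a eps)). assert (Hv' := Hv _ (locally_ball b eps)).
  unfold filtermap in *.
  apply (filter_imp (fun x => ball a eps (u x) /\ ball b eps (v x))).
  - intros x [H1 H2]. apply HP. now split.
  - now apply filter_and.
Qed.

Lemma filterlim_Re {A : Type} {F : (A -> Prop) -> Prop} (f : A -> C) (l : C) :
  filterlim f F (@locally C_UniformSpace l) ->
  filterlim (fun x => Re (f x)) F (locally (Re l)).
Proof.
  intros Hf P [eps HP]. apply (Hf (fun z => P (Re z))).
  exists eps. intros z [Hz _]. now apply HP.
Qed.

Lemma filterlim_Im {A : Type} {F : (A -> Prop) -> Prop} (f : A -> C) (l : C) :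
  filterlim f F (@locally C_UniformSpace l) ->
  filterlim (fun x => Im (f x)) F (locally (Im l)).
Proof.
  intros Hf P [eps HP]. apply (Hf (fun z => P (Im z))).
  exists eps. intros z [_ Hz]. now apply HP.
Qed.

Lemma is_RInt_gen_C_pair (u v : R -> R) (Fa Fb : (R -> Prop) -> Prop)
    {FFa : Filter Fa} {FFb : Filter Fb} (a b : R) :
  is_RInt_gen u Fa Fb a -> is_RInt_gen v Fa Fb b ->
  is_RInt_gen (V := C_R_NormedModule) (fun x => (u x, v x)) Fa Fb (a, b).
Proof.
  intros Hu Hv P [eps HP].
  assert (Hu' := Hu _ (locally_ball a eps)). assert (Hv' := Hv _ (locally_ball b eps)).
  unfold filtermapi in *.
  apply (filter_imp _ _) with (2 := filter_and _ _ Hu' Hv').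
  intros [p q] [[y [Iy By]] [z [Iz Bz]]]. exists (y, z). split.
  - now apply (is_RInt_fct_extend_pair (U := R_NormedModule) (V := R_NormedModule)).
  - apply HP. now split.
Qed.

Lemma is_RInt_gen_antiderivative (f F : R -> R) (lm lp : R) :
  (forall x, is_derive F x (f x)) -> (forall x, continuous f x) ->
  is_lim F m_infty lm -> is_lim F p_infty lp ->
  is_RInt_gen f (Rbar_locally m_infty) (Rbar_locally p_infty) (lp - lm).
Proof.
  intros HF Hf Lm Lp.
  assert (E : forall x, Derive F x = f x) by (intros x; now apply is_derive_unique).
  apply is_RInt_gen_ext with (Derive F).
  - apply filter_forall. intros ab x _. apply E.
  - apply is_RInt_gen_Derive.
    + apply filter_forall. intros ab x _. now exists (f x).
    + apply filter_forall. intros ab x _.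
      apply continuous_ext with f; [intros; now rewrite E | apply Hf].
    + apply Lm.
    + apply Lp.
Qed.

Lemma is_lim_reflect (f : R -> R) (l : R) :
  is_lim f p_infty l -> is_lim (fun x => f (- x)) m_infty l.
Proof.
  intros Hf. apply is_lim_comp with p_infty; [exact Hf | | ].
  - apply (is_lim_opp (fun x => x) m_infty m_infty), is_lim_id.
  - apply filter_forall. intros; discriminate.
Qed.

Lemma RInt_0_opp (f : R -> R) (x : R) :
  (forall y, continuous f y) ->
  RInt f 0 (- x) = - RInt (fun y => f (- y)) 0 x.
Proof.
  intros Hf.
  assert (I : is_RInt f (- 0) (- x) (RInt f 0 (- x))).
  { rewrite Ropp_0. apply (@RInt_correct R_CompleteNormedModule).
    apply (@ex_RInt_continuous R_CompleteNormedModule). intros; apply Hf. }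
  apply is_RInt_comp_opp, is_RInt_opp in I.
  apply (is_RInt_ext _ (fun y => f (- y))) in I.
  - apply (is_RInt_unique (V := R_CompleteNormedModule)) in I. rewrite I.
    symmetry. apply Ropp_involutive.
  - intros y _. apply Ropp_involutive.
Qed.

Lemma is_lim_sech (p : Rbar) : p = m_infty \/ p = p_infty -> is_lim sech p 0.
Proof.
  assert (L : is_lim sech p_infty 0).
  { apply is_lim_dominated_0 with (fun x => exp (- (1 * x))) 2.
    - intros x. rewrite Rabs_right by (apply Rle_ge, Rlt_le, sech_pos).
      rewrite Rmult_1_l. apply sech_le_exp.
    - apply is_lim_exp_neg. lra. }
  intros [-> | ->]; [ | exact L].
  apply is_lim_ext with (fun x => sech (- x)); [intros; apply sech_opp | ].
  now apply is_lim_reflect.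
Qed.

Lemma is_lim_RInt_sech_dominated (f : R -> R) (K : R) :
  (forall x, continuous f x) -> (forall x, Rabs (f x) <= K * sech x) ->
  exists l : R, is_lim (RInt f 0) p_infty l.
Proof.
  intros Hf HK.
  assert (HK0 : 0 <= K).
  { assert (H1 := HK 0). assert (H2 := Rabs_pos (f 0)). assert (H3 := sech_pos 0). nra. }
  apply (filterlim_locally_cauchy (U := R_CompleteSpace) (F := Rbar_locally p_infty)).
  intros eps.
  assert (L : is_lim (fun x => 2 * K * exp (- (1 * x))) p_infty 0).
  { replace (Finite 0) with (Rbar_mult (2 * K) 0) by (simpl; f_equal; ring).
    apply is_lim_scal_l, is_lim_exp_neg. lra. }
  apply is_lim_spec in L. specialize (L eps).
  exists (fun x => Rabs (2 * K * exp (- (1 * x)) - 0) < eps). split; [exact L | ].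
  assert (B : forall u v, u <= v -> Rabs (2 * K * exp (- (1 * u)) - 0) < eps ->
             Rabs (RInt f 0 v - RInt f 0 u) < eps).
  { intros u v Huv Hu.
    assert (D := is_derive_dominated (RInt f 0) (fun x => - (2 * K * exp (- (1 * x)))) f
      (fun x => 2 * K * exp (- (1 * x))) u v Huv).
    cbv beta in D. rewrite Rminus_0_r in Hu. apply Rabs_lt_between in Hu.
    assert (Hv : 0 <= 2 * K * exp (- (1 * v))).
    { assert (H1 := exp_pos (- (1 * v))). nra. }
    apply Rle_lt_trans with (- (2 * K * exp (- (1 * v))) - - (2 * K * exp (- (1 * u))));
      [ | lra].
    apply D.
    - intros x _. now apply is_derive_primitive.
    - intros x _. auto_derive; [trivial | ring].
    - intros x _. eapply Rle_trans; [apply HK | ].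
      rewrite Rmult_1_l. assert (H1 := sech_le_exp x). nra. }
  intros u v Hu Hv. change (Rabs (RInt f 0 v - RInt f 0 u) < eps).
  destruct (Rle_dec u v) as [H | H]; [now apply B | ].
  rewrite Rabs_minus_sym. apply B; [lra | easy].
Qed.

Lemma is_RInt_gen_odd (f : R -> R) (K : R) :
  (forall x, continuous f x) -> (forall x, Rabs (f x) <= K * sech x) ->
  (forall x, f (- x) = - f x) ->
  is_RInt_gen f (Rbar_locally m_infty) (Rbar_locally p_infty) 0.
Proof.
  intros Hf HK Hodd. destruct (is_lim_RInt_sech_dominated f K Hf HK) as [l Hl].
  replace 0 with (l - l) by ring.
  apply is_RInt_gen_antiderivative with (RInt f 0).
  - intros x. now apply is_derive_primitive.
  - exact Hf.
  - apply is_lim_ext with (fun x => RInt f 0 (- x)); [ | now apply is_lim_reflect].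
    intros x. rewrite RInt_0_opp by exact Hf.
    rewrite (RInt_ext (fun y => f (- y)) (fun y => opp (f y))) by (intros; apply Hodd).
    rewrite (RInt_opp (V := R_CompleteNormedModule)).
    + apply Ropp_involutive.
    + apply (@ex_RInt_continuous R_CompleteNormedModule). intros; apply Hf.
  - exact Hl.
Qed.

Lemma is_RInt_gen_sech_cos (xi : R) :
  0 <= xi ->
  is_RInt_gen (fun x => sech x * cos (xi * x)) (Rbar_locally m_infty) (Rbar_locally p_infty)
    (PI * sech (PI * xi / 2)).
Proof.
  intros Hxi. assert (L := RInt_sech_cos_lim xi Hxi).
  replace (PI * xi / 2) with (xi * (PI / 2)) by field.
  set (l := PI / 2 * sech (xi * (PI / 2))) in L.
  replace (PI * sech (xi * (PI / 2))) with (l - - l) by (unfold l; field).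
  assert (Hf := continuous_sech_cos xi).
  apply is_RInt_gen_antiderivative with (RInt (fun y => sech y * cos (xi * y)) 0).
  - intros x. apply (is_derive_primitive (fun y => sech y * cos (xi * y))). exact Hf.
  - exact Hf.
  - apply is_lim_ext with (fun x => - RInt (fun y => sech y * cos (xi * y)) 0 (- x)).
    + intros x. rewrite RInt_0_opp by exact Hf. rewrite Ropp_involutive.
      apply RInt_ext. intros y _. rewrite sech_opp, <- Ropp_mult_distr_r, cos_neg. reflexivity.
    + apply (is_lim_opp (fun x => RInt (fun y => sech y * cos (xi * y)) 0 (- x)) m_infty l).
      now apply is_lim_reflect.
  - exact L.
Qed.

(** * Jost solutions and the transmission coefficient *)

(* [jost_re + i jost_im = e^(i x xi) (3 tanh^2 x - 1 - xi^2 - 3 i xi tanh x)], which is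
   the Jost solution up to the factor [(1 - i xi) (2 - i xi)]. *)
Definition jost_re (xi x : R) : R :=
  (3 * tanh x ^ 2 - 1 - xi ^ 2) * cos (xi * x) + 3 * xi * tanh x * sin (xi * x).

Definition jost_im (xi x : R) : R :=
  (3 * tanh x ^ 2 - 1 - xi ^ 2) * sin (xi * x) - 3 * xi * tanh x * cos (xi * x).

Definition jost_re' (xi x : R) : R :=
  (6 * tanh x * sech x ^ 2 + 3 * xi ^ 2 * tanh x) * cos (xi * x)
  + (3 * xi * sech x ^ 2 - xi * (3 * tanh x ^ 2 - 1 - xi ^ 2)) * sin (xi * x).

Definition jost_im' (xi x : R) : R :=
  (6 * tanh x * sech x ^ 2 + 3 * xi ^ 2 * tanh x) * sin (xi * x)
  - (3 * xi * sech x ^ 2 - xi * (3 * tanh x ^ 2 - 1 - xi ^ 2)) * cos (xi * x).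

(* [|(1 - i xi) (2 - i xi)|^2] *)
Definition jost_norm2 (xi : R) : R := (1 + xi ^ 2) * (4 + xi ^ 2).

Lemma jost_norm2_pos (xi : R) : 0 < jost_norm2 xi.
Proof.
  unfold jost_norm2. assert (H1 := pow2_ge_0 xi). apply Rmult_lt_0_compat; lra.
Qed.

Lemma Derive_sech (x : R) : Derive (fun y => sech y) x = - (sech x * tanh x).
Proof. apply is_derive_unique, is_derive_sech. Qed.

Lemma Derive_tanh (x : R) : Derive (fun y => tanh y) x = sech x ^ 2.
Proof. apply is_derive_unique, is_derive_tanh. Qed.

Lemma ex_derive_sech (x : R) : ex_derive (fun y => sech y) x.
Proof. eexists. apply is_derive_sech. Qed.

Lemma ex_derive_tanh (x : R) : ex_derive (fun y => tanh y) x.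
Proof. eexists. apply is_derive_tanh. Qed.

Ltac derive_sech_tanh :=
  auto_derive;
  [ repeat split; first [apply ex_derive_sech | apply ex_derive_tanh]
  | rewrite ?Derive_sech, ?Derive_tanh ].

Lemma is_derive_jost_re (xi x : R) : is_derive (jost_re xi) x (jost_re' xi x).
Proof. unfold jost_re, jost_re'. derive_sech_tanh. ring. Qed.

Lemma is_derive_jost_im (xi x : R) : is_derive (jost_im xi) x (jost_im' xi x).
Proof. unfold jost_im, jost_im'. derive_sech_tanh. ring. Qed.

Lemma is_derive_jost_re' (xi x : R) :
  is_derive (jost_re' xi) x (- (6 * sech x ^ 2 + xi ^ 2) * jost_re xi x).
Proof.
  unfold jost_re', jost_re. derive_sech_tanh.
  assert (E := tanh_sqr x).
  replace (sech x * (sech x * 1)) with (1 - tanh x ^ 2) by lra.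
  replace (sech x ^ 2) with (1 - tanh x ^ 2) by lra.
  ring_simplify. replace (sech x ^ 2) with (1 - tanh x ^ 2) by lra. ring.
Qed.

Lemma is_derive_jost_im' (xi x : R) :
  is_derive (jost_im' xi) x (- (6 * sech x ^ 2 + xi ^ 2) * jost_im xi x).
Proof.
  unfold jost_im', jost_im. derive_sech_tanh.
  assert (E := tanh_sqr x).
  replace (sech x * (sech x * 1)) with (1 - tanh x ^ 2) by lra.
  replace (sech x ^ 2) with (1 - tanh x ^ 2) by lra.
  ring_simplify. replace (sech x ^ 2) with (1 - tanh x ^ 2) by lra. ring.
Qed.

Lemma jost_wronskian (xi x : R) :
  jost_re xi x * jost_im' xi x - jost_re' xi x * jost_im xi x = xi * jost_norm2 xi.
Proof.
  unfold jost_re, jost_im, jost_re', jost_im', jost_norm2.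
  assert (E := tanh_sqr x). assert (E' := sin2_cos2 (xi * x)). unfold Rsqr in E'.
  replace (sech x ^ 2) with (1 - tanh x ^ 2) by lra.
  transitivity ((sin (xi * x) * sin (xi * x) + cos (xi * x) * cos (xi * x)) *
    (xi * ((1 + xi ^ 2) * (4 + xi ^ 2)))); [ring | rewrite E'; ring].
Qed.

Lemma jost_re_opp (xi x : R) : jost_re xi (- x) = jost_re xi x.
Proof.
  unfold jost_re. rewrite tanh_opp, <- Ropp_mult_distr_r, cos_neg, sin_neg. ring.
Qed.

Lemma jost_im_opp (xi x : R) : jost_im xi (- x) = - jost_im xi x.
Proof.
  unfold jost_im. rewrite tanh_opp, <- Ropp_mult_distr_r, cos_neg, sin_neg. ring.
Qed.

Lemma is_lim_shift (f : R -> R) (c l : R) :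
  is_lim f p_infty l -> is_lim (fun x => f (x + c)) p_infty l.
Proof.
  intros Hf. apply is_lim_comp with p_infty; [exact Hf | | ].
  - replace p_infty with (Rbar_plus p_infty c) at 2 by easy.
    apply is_lim_plus with p_infty c; [apply is_lim_id | apply is_lim_const | easy].
  - apply filter_forall. intros; discriminate.
Qed.

(* A quarter period later the sinusoid is in quadrature, and the two squares add up to
   the constant [a^2 + b^2]. *)
Lemma sinusoid_lim_0 (a b xi : R) :
  xi <> 0 -> is_lim (fun x => a * cos (xi * x) + b * sin (xi * x)) p_infty 0 ->
  a = 0 /\ b = 0.
Proof.
  intros Hxi L. assert (L' := is_lim_shift _ (PI / 2 / xi) 0 L).
  assert (S : is_lim (fun x => a ^ 2 + b ^ 2) p_infty (0 * 0 + 0 * 0)).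
  { eapply is_lim_ext; [ | apply is_lim_plus';
      [exact (is_lim_mult _ _ _ _ _ L L I) | exact (is_lim_mult _ _ _ _ _ L' L' I)]].
    intros x. cbv beta.
    replace (xi * (x + PI / 2 / xi)) with (PI / 2 + xi * x) by (field; easy).
    rewrite <- (cos_sin (xi * x)).
    replace (cos (PI / 2 + xi * x)) with (- sin (xi * x)) by (rewrite sin_cos; ring).
    assert (E' := sin2_cos2 (xi * x)). unfold Rsqr in E'.
    transitivity ((sin (xi * x) * sin (xi * x) + cos (xi * x) * cos (xi * x)) * (a ^ 2 + b ^ 2));
      [ring | rewrite E'; ring]. }
  apply is_lim_unique in S. rewrite Lim_const in S. injection S as S.
  assert (H1 := pow2_ge_0 a). assert (H2 := pow2_ge_0 b).
  split; nra.
Qed.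

Lemma is_lim_tanh_sub_1 : is_lim (fun x => tanh x - 1) p_infty 0.
Proof.
  apply is_lim_le_le_loc with (fun x => - sech x) (fun _ => 0).
  - exists 0. intros x Hx.
    assert (E := tanh_sqr x). assert (H1 := sech_pos x). assert (H2 := sech_le_1 x).
    assert (Ht : 0 < tanh x).
    { unfold tanh. apply Rdiv_lt_0_compat; [ | apply cosh_pos].
      rewrite <- sinh_0. now apply sinh_lt. }
    split; nra.
  - replace (Finite 0) with (Rbar_opp 0) by (simpl; f_equal; ring).
    apply is_lim_opp, is_lim_sech. now right.
  - apply is_lim_const.
Qed.

Lemma is_lim_tanh : is_lim tanh p_infty 1.
Proof.
  apply is_lim_ext with (fun x => (tanh x - 1) + 1); [intros; ring | ].
  replace (Finite 1) with (Finite (0 + 1)) by (f_equal; ring).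
  apply is_lim_plus'; [apply is_lim_tanh_sub_1 | apply is_lim_const].
Qed.

Lemma Rabs_tanh_le_1 (x : R) : Rabs (tanh x) <= 1.
Proof.
  assert (E := tanh_sqr x). assert (H1 := pow2_ge_0 (sech x)).
  apply Rabs_le_between. nra.
Qed.

Lemma constant_of_derive_0 (f : R -> R) :
  (forall x, is_derive f x 0) -> forall x, f x = f 0.
Proof.
  intros Hf x.
  destruct (MVT_gen f 0 x (fun _ => 0)) as [c [_ E]].
  - intros; apply Hf.
  - intros y _. apply derivable_continuous_pt. exists 0. apply is_derive_Reals, Hf.
  - lra.
Qed.

(* By constancy of the Wronskians with [jost_re] and [jost_im], [y] is a combination of
   the two, hence asymptotic to a sinusoid. *)
Lemma decaying_solution_0 (xi : R) (y y' : R -> R) :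
  xi <> 0 ->
  (forall x, is_derive y x (y' x)) ->
  (forall x, is_derive y' x (- (6 * sech x ^ 2 + xi ^ 2) * y x)) ->
  is_lim y p_infty 0 -> forall x, y x = 0.
Proof.
  intros Hxi Dy Dy' L.
  assert (HW : forall (z z' : R -> R),
    (forall x, is_derive z x (z' x)) ->
    (forall x, is_derive z' x (- (6 * sech x ^ 2 + xi ^ 2) * z x)) ->
    forall x, y x * z' x - y' x * z x = y 0 * z' 0 - y' 0 * z 0).
  { intros z z' Dz Dz'.
    apply (constant_of_derive_0 (fun x => y x * z' x - y' x * z x)). intros x.
    replace 0 with ((y' x * z' x + y x * (- (6 * sech x ^ 2 + xi ^ 2) * z x))
       - (- (6 * sech x ^ 2 + xi ^ 2) * y x * z x + y' x * z' x)) by ring.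
    apply @is_derive_minus.
    - apply (is_derive_mult y z'); [apply Dy | apply Dz' | intros; apply Rmult_comm].
    - apply (is_derive_mult y' z); [apply Dy' | apply Dz | intros; apply Rmult_comm]. }
  assert (W1 := HW _ _ (is_derive_jost_re xi) (is_derive_jost_re' xi)).
  assert (W2 := HW _ _ (is_derive_jost_im xi) (is_derive_jost_im' xi)).
  set (k1 := y 0 * jost_re' xi 0 - y' 0 * jost_re xi 0) in W1.
  set (k2 := y 0 * jost_im' xi 0 - y' 0 * jost_im xi 0) in W2.
  assert (Hn := jost_norm2_pos xi).
  assert (E : forall x, xi * jost_norm2 xi * y x = k2 * jost_re xi x - k1 * jost_im xi x).
  { intros x. rewrite <- (jost_wronskian xi x), <- (W1 x), <- (W2 x). ring. }
  destruct (sinusoid_lim_0 (k2 * (2 - xi ^ 2) + 3 * xi * k1) (3 * xi * k2 - k1 * (2 - xi ^ 2)) xi Hxi)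
    as [Ea Eb].
  { apply is_lim_ext with (fun x => xi * jost_norm2 xi * y x + (tanh x - 1) *
      - (3 * (tanh x + 1) * (k2 * cos (xi * x) - k1 * sin (xi * x))
         + 3 * xi * (k2 * sin (xi * x) + k1 * cos (xi * x)))).
    - intros x. rewrite E. unfold jost_re, jost_im. ring.
    - replace (Finite 0) with (Finite (xi * jost_norm2 xi * 0 + 0)) by (f_equal; ring).
      apply is_lim_plus'.
      + now apply (is_lim_scal_l y (xi * jost_norm2 xi) p_infty 0).
      + apply is_lim_dominated_0 with (fun x => Rabs (tanh x - 1))
          (6 * (Rabs k2 + Rabs k1) + 3 * Rabs xi * (Rabs k2 + Rabs k1)).
        * intros x. rewrite Rabs_mult, Rabs_Ropp, Rmult_comm.
          apply Rmult_le_compat_r; [apply Rabs_pos | ].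
          assert (Hc := Rabs_cos_le_1 (xi * x)). assert (Hs := Rabs_sin_le_1 (xi * x)).
          assert (P1 := Rabs_pos k1). assert (P2 := Rabs_pos k2).
          assert (P3 := Rabs_pos xi).
          assert (P4 := Rabs_pos (cos (xi * x))). assert (P5 := Rabs_pos (sin (xi * x))).
          assert (A1 : Rabs (k2 * cos (xi * x) - k1 * sin (xi * x)) <= Rabs k2 + Rabs k1).
          { eapply Rle_trans; [apply Rabs_triang | ]. rewrite Rabs_Ropp, 2!Rabs_mult. nra. }
          assert (A2 : Rabs (k2 * sin (xi * x) + k1 * cos (xi * x)) <= Rabs k2 + Rabs k1).
          { eapply Rle_trans; [apply Rabs_triang | ]. rewrite 2!Rabs_mult. nra. }
          assert (A3 : Rabs (3 * (tanh x + 1)) <= 6).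
          { assert (Ht := Rabs_tanh_le_1 x). apply Rabs_le_between in Ht.
            apply Rabs_le_between. lra. }
          eapply Rle_trans; [apply Rabs_triang | ].
          rewrite (Rabs_mult (3 * (tanh x + 1))), (Rabs_mult (3 * xi)), (Rabs_mult 3 xi),
            (Rabs_right 3) by lra.
          apply Rplus_le_compat; apply Rmult_le_compat; try apply Rabs_pos; try easy; nra.
        * replace (Finite 0) with (Rbar_abs 0) by (simpl; now rewrite Rabs_R0).
          apply is_lim_Rabs, is_lim_tanh_sub_1. }
  assert (K : k1 = 0 /\ k2 = 0).
  { unfold jost_norm2 in Hn.
    assert (E1 : k1 * ((1 + xi ^ 2) * (4 + xi ^ 2)) = 0).
    { transitivity (3 * xi * (k2 * (2 - xi ^ 2) + 3 * xi * k1)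
        - (2 - xi ^ 2) * (3 * xi * k2 - k1 * (2 - xi ^ 2))); [ring | rewrite Ea, Eb; ring]. }
    assert (E2 : k2 * ((1 + xi ^ 2) * (4 + xi ^ 2)) = 0).
    { transitivity ((2 - xi ^ 2) * (k2 * (2 - xi ^ 2) + 3 * xi * k1)
        + 3 * xi * (3 * xi * k2 - k1 * (2 - xi ^ 2))); [ring | rewrite Ea, Eb; ring]. }
    apply Rmult_integral in E1. apply Rmult_integral in E2. split; lra. }
  destruct K as [-> ->]. intros x. specialize (E x).
  assert (E0 : xi * jost_norm2 xi * y x = 0) by lra.
  apply Rmult_integral in E0. destruct E0 as [E0 | E0]; [ | easy].
  apply Rmult_integral in E0. lra.
Qed.

Lemma is_derive_C_pair (u v : R -> R) (x a b : R) :
  is_derive u x a -> is_derive v x b ->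
  is_derive (K := R_AbsRing) (V := C_R_NormedModule) (fun y => (u y, v y)) x (a, b).
Proof.
  intros Hu Hv.
  apply (is_derive_ext (V := C_R_NormedModule)
    (fun y => plus (scal (u y) ((1, 0) : C_R_NormedModule)) (scal (v y) ((0, 1) : C_R_NormedModule)))).
  - intros y. apply injective_projections; simpl; unfold scal, plus; simpl; unfold mult; simpl; ring.
  - replace (a, b) with (plus (scal a ((1, 0) : C_R_NormedModule)) (scal b ((0, 1) : C_R_NormedModule))).
    + apply (is_derive_plus (V := C_R_NormedModule)); now apply (is_derive_scal_l (V := C_R_NormedModule)).
    + apply injective_projections; simpl; unfold scal, plus; simpl; unfold mult; simpl; ring.
Qed.

Lemma ex_derive_Re (f : R -> C) (x : R) :
  ex_derive (K := R_AbsRing) (V := C_R_NormedModule) f x -> ex_derive (fun y => Re (f y)) x.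
Proof.
  intros [l Hl]. exists (Re l).
  apply (filterdiff_comp' (V := C_R_NormedModule) (W := R_NormedModule) f Re x _ Re Hl).
  apply filterdiff_linear, (is_linear_fst (U := R_NormedModule) (V := R_NormedModule)).
Qed.

Lemma ex_derive_Im (f : R -> C) (x : R) :
  ex_derive (K := R_AbsRing) (V := C_R_NormedModule) f x -> ex_derive (fun y => Im (f y)) x.
Proof.
  intros [l Hl]. exists (Im l).
  apply (filterdiff_comp' (V := C_R_NormedModule) (W := R_NormedModule) f Im x _ Im Hl).
  apply filterdiff_linear, (is_linear_snd (U := R_NormedModule) (V := R_NormedModule)).
Qed.

Lemma CDerive_pair (u v u' v' : R -> R) :
  (forall x, is_derive u x (u' x)) -> (forall x, is_derive v x (v' x)) ->
  CDerive (fun x => (u x, v x)) = fun x => (u' x, v' x).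
Proof.
  intros Hu Hv. apply functional_extensionality. intros x. unfold CDerive.
  f_equal; apply is_derive_unique; [apply Hu | apply Hv].
Qed.

Definition solves_real (xi : R) (y y' : R -> R) : Prop :=
  (forall x, is_derive y x (y' x)) /\
  (forall x, is_derive y' x (- (6 * sech x ^ 2 + xi ^ 2) * y x)).

Lemma solves_real_lin (xi a b : R) (y y' z z' : R -> R) :
  solves_real xi y y' -> solves_real xi z z' ->
  solves_real xi (fun x => a * y x + b * z x) (fun x => a * y' x + b * z' x).
Proof.
  intros [Hy Hy'] [Hz Hz']. split; intros x.
  - apply @is_derive_plus; now apply is_derive_scal.
  - replace (- (6 * sech x ^ 2 + xi ^ 2) * (a * y x + b * z x)) with
      (a * (- (6 * sech x ^ 2 + xi ^ 2) * y x) + b * (- (6 * sech x ^ 2 + xi ^ 2) * z x))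
      by ring.
    apply @is_derive_plus; now apply is_derive_scal.
Qed.

Lemma is_derive_reflect (f : R -> R) (x l : R) :
  is_derive f (- x) l -> is_derive (fun y => f (- y)) x (- l).
Proof.
  intros Hf. replace (- l) with (scal (-1) l) by (unfold scal; simpl; unfold mult; simpl; ring).
  apply (is_derive_comp f Ropp); [exact Hf | ]. auto_derive; [trivial | ring].
Qed.

Lemma solves_real_reflect (xi : R) (y y' : R -> R) :
  solves_real xi y y' -> solves_real xi (fun x => y (- x)) (fun x => - y' (- x)).
Proof.
  intros [Hy Hy']. split; intros x.
  - now apply is_derive_reflect.
  - replace (- (6 * sech x ^ 2 + xi ^ 2) * y (- x)) with
      (- - (- (6 * sech (- x) ^ 2 + xi ^ 2) * y (- x))) by (rewrite sech_opp; ring).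
    apply @is_derive_opp. apply is_derive_reflect. apply Hy'.
Qed.

Lemma is_eigensolution_pair (xi : R) (u u' v v' : R -> R) :
  solves_real xi u u' -> solves_real xi v v' -> is_eigensolution xi (fun x => (u x, v x)).
Proof.
  intros [Hu Hu'] [Hv Hv'].
  assert (E := CDerive_pair _ _ _ _ Hu Hv). assert (E' := CDerive_pair _ _ _ _ Hu' Hv').
  repeat split.
  - intros x. exists (u' x, v' x). now apply is_derive_C_pair.
  - intros x. rewrite E. eexists. apply is_derive_C_pair; [apply Hu' | apply Hv'].
  - intros x. unfold H. rewrite E, E'. apply injective_projections; simpl; ring.
Qed.

Lemma eigensolution_Re_Im (xi : R) (f : R -> C) :
  is_eigensolution xi f ->
  solves_real xi (fun x => Re (f x)) (Derive (fun x => Re (f x))) /\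
  solves_real xi (fun x => Im (f x)) (Derive (fun x => Im (f x))).
Proof.
  intros [[D1 D2] E].
  split; split; intros x.
  - apply Derive_correct. now apply ex_derive_Re.
  - assert (D := Derive_correct _ _ (ex_derive_Re _ _ (D2 x))).
    replace (- (6 * sech x ^ 2 + xi ^ 2) * Re (f x))
      with (Derive (fun y => Re (CDerive f y)) x); [exact D | ].
    assert (E1 : - Derive (fun y => Re (CDerive f y)) x
        - (6 * sech x ^ 2 * Re (f x) - 0 * Im (f x)) = xi ^ 2 * Re (f x) - 0 * Im (f x))
      by exact (f_equal Re (E x)).
    lra.
  - apply Derive_correct. now apply ex_derive_Im.
  - assert (D := Derive_correct _ _ (ex_derive_Im _ _ (D2 x))).
    replace (- (6 * sech x ^ 2 + xi ^ 2) * Im (f x))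
      with (Derive (fun y => Im (CDerive f y)) x); [exact D | ].
    assert (E1 : - Derive (fun y => Im (CDerive f y)) x
        - (6 * sech x ^ 2 * Im (f x) + 0 * Re (f x)) = xi ^ 2 * Im (f x) + 0 * Re (f x))
      by exact (f_equal Im (E x)).
    lra.
Qed.

(* Real and imaginary part of [1 / ((1 - i xi) (2 - i xi))]. *)
Definition jost_coef1 (xi : R) : R := (2 - xi ^ 2) / jost_norm2 xi.
Definition jost_coef2 (xi : R) : R := 3 * xi / jost_norm2 xi.

Definition jost (xi x : R) : C :=
  (jost_coef1 xi * jost_re xi x + - jost_coef2 xi * jost_im xi x,
   jost_coef2 xi * jost_re xi x + jost_coef1 xi * jost_im xi x).

Lemma solves_real_jost_re (xi : R) : solves_real xi (jost_re xi) (jost_re' xi).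
Proof. split; [apply is_derive_jost_re | apply is_derive_jost_re']. Qed.

Lemma solves_real_jost_im (xi : R) : solves_real xi (jost_im xi) (jost_im' xi).
Proof. split; [apply is_derive_jost_im | apply is_derive_jost_im']. Qed.

Lemma is_eigensolution_jost (xi : R) : is_eigensolution xi (jost xi).
Proof.
  assert (H1 := solves_real_jost_re xi). assert (H2 := solves_real_jost_im xi).
  eapply is_eigensolution_pair; apply solves_real_lin; eassumption.
Qed.

Lemma is_jost_plus_jost (xi : R) : is_jost_plus xi (jost xi).
Proof.
  split; [apply is_eigensolution_jost | ].
  assert (Hn := jost_norm2_pos xi).
  assert (L : forall a b, is_lim (fun x => a * (3 * (tanh x * tanh x) - 1 - xi ^ 2) + b * tanh x)
    p_infty (a * (3 * (1 * 1) - 1 - xi ^ 2) + b * 1)).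
  { intros a b. apply is_lim_plus'.
    - apply (is_lim_scal_l _ a p_infty (3 * (1 * 1) - 1 - xi ^ 2)).
      apply is_lim_minus'; [apply is_lim_minus' | apply is_lim_const]; [ | apply is_lim_const].
      apply (is_lim_scal_l _ 3 p_infty (1 * 1)).
      exact (is_lim_mult _ _ _ _ _ is_lim_tanh is_lim_tanh I).
    - apply (is_lim_scal_l _ b p_infty 1), is_lim_tanh. }
  assert (Lp := filterlim_C_pair _ _ _ _ (L (jost_coef1 xi) (3 * xi * jost_coef2 xi))
    (L (jost_coef2 xi) (- (3 * xi * jost_coef1 xi)))).
  eapply filterlim_ext; [ | eapply filterlim_filter_le_2; [ | exact Lp]].
  - intros x. unfold jost, expi.
    assert (E := sin2_cos2 (xi * x)). unfold Rsqr in E.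
    rewrite cos_neg, sin_neg, (Rmult_comm x xi).
    apply injective_projections; simpl; unfold jost_re, jost_im.
    + transitivity ((sin (xi * x) * sin (xi * x) + cos (xi * x) * cos (xi * x)) *
        (jost_coef1 xi * (3 * (tanh x * tanh x) - 1 - xi ^ 2) + 3 * xi * jost_coef2 xi * tanh x));
        [rewrite E; ring | ring].
    + transitivity ((sin (xi * x) * sin (xi * x) + cos (xi * x) * cos (xi * x)) *
        (jost_coef2 xi * (3 * (tanh x * tanh x) - 1 - xi ^ 2) + - (3 * xi * jost_coef1 xi) * tanh x));
        [rewrite E; ring | ring].
  - replace (RtoC 1) with
      ((jost_coef1 xi * (3 * (1 * 1) - 1 - xi ^ 2) + 3 * xi * jost_coef2 xi * 1,
       jost_coef2 xi * (3 * (1 * 1) - 1 - xi ^ 2) + - (3 * xi * jost_coef1 xi) * 1) : C).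
    + intros P HP. exact HP.
    + unfold jost_coef1, jost_coef2. unfold jost_norm2 in *.
      apply injective_projections; simpl; field; split; nra.
Qed.

Lemma Cmod_le_Rabs (z : C) : Cmod z <= Rabs (Re z) + Rabs (Im z).
Proof.
  unfold Cmod. assert (H1 := Rabs_pos (Re z)). assert (H2 := Rabs_pos (Im z)).
  rewrite <- (sqrt_pow2 (Rabs (Re z) + Rabs (Im z))) by lra.
  apply sqrt_le_1_alt. rewrite <- (pow2_abs (fst z)), <- (pow2_abs (snd z)).
  unfold Re, Im in *. nra.
Qed.

Lemma jost_plus_unique (xi : R) (f : R -> C) :
  xi <> 0 -> is_jost_plus xi f -> f = jost xi.
Proof.
  intros Hxi [Ef Lf]. destruct (is_jost_plus_jost xi) as [Ej Lj].
  destruct (eigensolution_Re_Im _ _ Ef) as [Rf If].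
  destruct (eigensolution_Re_Im _ _ Ej) as [Rj Ij].
  set (d := fun x => (f x - jost xi x)%C).
  assert (Ld : is_lim (fun x => Cmod (d x)) p_infty 0).
  { set (p := fun x => (expi (- (x * xi)) * f x)%C).
    set (q := fun x => (expi (- (x * xi)) * jost xi x)%C).
    assert (P1 : is_lim (fun x => Re (p x)) p_infty 1) by exact (filterlim_Re p 1 Lf).
    assert (P2 : is_lim (fun x => Im (p x)) p_infty 0) by exact (filterlim_Im p 1 Lf).
    assert (Q1 : is_lim (fun x => Re (q x)) p_infty 1) by exact (filterlim_Re q 1 Lj).
    assert (Q2 : is_lim (fun x => Im (q x)) p_infty 0) by exact (filterlim_Im q 1 Lj).
    assert (L : is_lim (fun x => Rabs (Re (p x) - Re (q x)) + Rabs (Im (p x) - Im (q x)))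
                  p_infty (Rabs (1 - 1) + Rabs (0 - 0))).
    { apply is_lim_plus'.
      - exact (is_lim_Rabs _ _ _ (is_lim_minus' _ _ _ _ _ P1 Q1)).
      - exact (is_lim_Rabs _ _ _ (is_lim_minus' _ _ _ _ _ P2 Q2)). }
    replace (Rabs (1 - 1) + Rabs (0 - 0)) with 0 in L
      by (rewrite !Rminus_diag, Rabs_R0; ring).
    refine (is_lim_dominated_0 _ _ 1 _ _ L). intros x.
    rewrite Rabs_right by apply Rle_ge, Cmod_ge_0. rewrite Rmult_1_l.
    replace (Cmod (d x)) with (Cmod (p x - q x)).
    - exact (Cmod_le_Rabs (p x - q x)).
    - replace (p x - q x)%C with (expi (- (x * xi)) * d x)%C
        by (unfold p, q, d; ring).
      rewrite Cmod_mult. replace (Cmod (expi (- (x * xi)))) with 1; [ring | ].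
      unfold Cmod, expi. simpl. rewrite !Rmult_1_r.
      assert (E := sin2_cos2 (- (x * xi))). unfold Rsqr in E.
      rewrite Rplus_comm, E. symmetry. apply sqrt_1. }
  assert (Z : forall y y' z z',
    solves_real xi y y' -> solves_real xi z z' ->
    (forall x, Rabs (y x - z x) <= Cmod (d x)) -> forall x, y x = z x).
  { intros y y' z z' Sy Sz Hd x.
    destruct (solves_real_lin xi 1 (-1) _ _ _ _ Sy Sz) as [D D'].
    assert (E := decaying_solution_0 xi _ _ Hxi D D').
    enough (1 * y x + -1 * z x = 0) by lra.
    apply E. apply is_lim_dominated_0 with (fun x => Cmod (d x)) 1; [ | exact Ld].
    intros t. replace (1 * y t + -1 * z t) with (y t - z t) by ring.
    rewrite Rmult_1_l. apply Hd. }
  apply functional_extensionality. intros x.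
  apply injective_projections.
  - apply (Z _ _ _ _ Rf Rj). intros t. eapply Rle_trans; [ | apply Rmax_Cmod].
    apply Rmax_l.
  - apply (Z _ _ _ _ If Ij). intros t. eapply Rle_trans; [ | apply Rmax_Cmod].
    apply Rmax_r.
Qed.

Lemma is_eigensolution_reflect (xi : R) (f : R -> C) :
  is_eigensolution xi f -> is_eigensolution xi (fun x => f (- x)).
Proof.
  intros Ef. destruct (eigensolution_Re_Im _ _ Ef) as [Rf If].
  replace (fun x => f (- x)) with (fun x => (Re (f (- x)), Im (f (- x)))).
  - eapply is_eigensolution_pair.
    + apply (solves_real_reflect _ _ _ Rf).
    + apply (solves_real_reflect _ _ _ If).
  - apply functional_extensionality. intros x. symmetry. apply surjective_pairing.
Qed.

Lemma filterlim_opp_infty (b : bool) :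
  filterlim Ropp (Rbar_locally (if b then p_infty else m_infty))
    (Rbar_locally (if b then m_infty else p_infty)).
Proof.
  destruct b; intros P [M HM]; exists (- M); intros x Hx; apply HM; lra.
Qed.

Lemma is_jost_minus_jost (xi : R) : is_jost_minus xi (fun x => jost xi (- x)).
Proof.
  destruct (is_jost_plus_jost xi) as [E L]. split; [now apply is_eigensolution_reflect | ].
  eapply filterlim_ext; [ | exact (filterlim_comp _ _ _ _ _ _ _ _ (filterlim_opp_infty false) L)].
  intros x. cbv beta. do 2 f_equal. ring.
Qed.

Lemma jost_minus_unique (xi : R) (f : R -> C) :
  xi <> 0 -> is_jost_minus xi f -> f = fun x => jost xi (- x).
Proof.
  intros Hxi [E L].
  assert (Ej : (fun x => f (- x)) = jost xi).
  { apply jost_plus_unique; [exact Hxi | ]. split; [now apply is_eigensolution_reflect | ].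
    eapply filterlim_ext; [ | exact (filterlim_comp _ _ _ _ _ _ _ _ (filterlim_opp_infty true) L)].
    intros x. cbv beta. do 2 f_equal. ring. }
  rewrite <- Ej. apply functional_extensionality. intros x. now rewrite Ropp_involutive.
Qed.

Lemma f_plus_eq (xi : R) : xi <> 0 -> f_plus xi = jost xi.
Proof.
  intros Hxi. apply jost_plus_unique; [exact Hxi | ].
  unfold f_plus. apply epsilon_spec. exists (jost xi). apply is_jost_plus_jost.
Qed.

Lemma f_minus_eq (xi : R) : xi <> 0 -> f_minus xi = fun x => jost xi (- x).
Proof.
  intros Hxi. apply jost_minus_unique; [exact Hxi | ].
  unfold f_minus. apply epsilon_spec. eexists. apply is_jost_minus_jost.
Qed.

(* [(1 - i xi) (2 - i xi) / ((1 + i xi) (2 + i xi))] *)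
Definition transmission (xi : R) : C :=
  (((2 - xi ^ 2) ^ 2 - 9 * xi ^ 2) / jost_norm2 xi, - 6 * xi * (2 - xi ^ 2) / jost_norm2 xi).

Lemma CDerive_jost (xi : R) :
  CDerive (jost xi) = fun x =>
    (jost_coef1 xi * jost_re' xi x + - jost_coef2 xi * jost_im' xi x,
     jost_coef2 xi * jost_re' xi x + jost_coef1 xi * jost_im' xi x).
Proof.
  apply CDerive_pair; intros x; apply @is_derive_plus; apply is_derive_scal;
    (apply is_derive_jost_re || apply is_derive_jost_im).
Qed.

Lemma jost_opp (xi x : R) :
  jost xi (- x) =
    (jost_coef1 xi * jost_re xi x + jost_coef2 xi * jost_im xi x,
     jost_coef2 xi * jost_re xi x + - jost_coef1 xi * jost_im xi x).
Proof.
  unfold jost. rewrite jost_re_opp, jost_im_opp. f_equal; ring.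
Qed.

Lemma CDerive_jost_opp (xi : R) :
  CDerive (fun x => jost xi (- x)) = fun x =>
    (jost_coef1 xi * jost_re' xi x + jost_coef2 xi * jost_im' xi x,
     jost_coef2 xi * jost_re' xi x + - jost_coef1 xi * jost_im' xi x).
Proof.
  rewrite (functional_extensionality _ _ (jost_opp xi)).
  apply CDerive_pair; intros x; apply @is_derive_plus; apply is_derive_scal;
    (apply is_derive_jost_re || apply is_derive_jost_im).
Qed.

Lemma transmission_mul_coef_sqr (xi : R) :
  (transmission xi
   * (jost_coef1 xi * jost_coef1 xi - jost_coef2 xi * jost_coef2 xi,
      2 * jost_coef1 xi * jost_coef2 xi)%R)%C = RtoC (/ jost_norm2 xi).
Proof.
  unfold transmission, jost_coef1, jost_coef2, jost_norm2.
  apply injective_projections; simpl; field; split; nra.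
Qed.

Lemma transmission_wronskian (xi x : R) :
  xi <> 0 ->
  (transmission xi * W (f_plus xi) (f_minus xi) x)%C = (- (2 * Ci * RtoC xi))%C.
Proof.
  intros Hxi. rewrite f_plus_eq, f_minus_eq by exact Hxi. unfold W.
  rewrite CDerive_jost, CDerive_jost_opp, jost_opp. unfold jost.
  assert (E := jost_wronskian xi x). assert (Hn := jost_norm2_pos xi).
  set (r := jost_re xi x) in *. set (i := jost_im xi x) in *.
  set (r' := jost_re' xi x) in *. set (i' := jost_im' xi x) in *.
  transitivity (transmission xi
    * (jost_coef1 xi * jost_coef1 xi - jost_coef2 xi * jost_coef2 xi,
       2 * jost_coef1 xi * jost_coef2 xi)%R
    * - (2 * Ci * RtoC (r * i' - r' * i)))%C.
  - rewrite <- Cmult_assoc. f_equal. apply injective_projections; simpl; ring.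
  - rewrite transmission_mul_coef_sqr, E.
    apply injective_projections; simpl; field; lra.
Qed.

Lemma is_transmission_transmission : is_transmission transmission.
Proof.
  split; [intros; now apply transmission_wronskian | ].
  assert (Hn := jost_norm2_pos 0).
  unfold continuous, transmission.
  apply (filterlim_C_pair (F := locally 0)).
  - apply (ex_derive_continuous (fun xi => ((2 - xi ^ 2) ^ 2 - 9 * xi ^ 2) / jost_norm2 xi)).
    unfold jost_norm2 in *. auto_derive. simpl in Hn |- *. lra.
  - apply (ex_derive_continuous (fun xi => - 6 * xi * (2 - xi ^ 2) / jost_norm2 xi)).
    unfold jost_norm2 in *. auto_derive. simpl in Hn |- *. lra.
Qed.

Lemma T_eq (xi : R) : xi <> 0 -> T xi = transmission xi.
Proof.
  intros Hxi.
  assert (ST : is_transmission T).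
  { unfold T. apply epsilon_spec. exists transmission. apply is_transmission_transmission. }
  assert (E := proj1 ST xi 0 Hxi). assert (E' := transmission_wronskian xi 0 Hxi).
  set (w := W (f_plus xi) (f_minus xi) 0) in *.
  assert (Hw : w <> RtoC 0).
  { intros Hw. rewrite Hw in E'. rewrite Cmult_0_r in E'.
    apply (f_equal Im) in E'. simpl in E'. lra. }
  rewrite <- E' in E.
  transitivity (T xi * w / w)%C; [field; exact Hw | rewrite E; field; exact Hw].
Qed.

(** * The transform of the source *)

Lemma transmission_mul_jost (xi x : R) :
  (transmission xi * jost xi x)%C =
    (jost_coef1 xi * jost_re xi x + jost_coef2 xi * jost_im xi x,
     jost_coef1 xi * jost_im xi x - jost_coef2 xi * jost_re xi x).
Proof.
  unfold transmission, jost, jost_coef1, jost_coef2, jost_norm2.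
  apply injective_projections; simpl; field; split; nra.
Qed.

Lemma sqrt3_sqr : sqrt 3 ^ 2 = 3.
Proof. apply pow2_sqrt. lra. Qed.

Lemma sqrt3_pos : 0 < sqrt 3.
Proof. apply sqrt_lt_R0. lra. Qed.

Definition source (x : R) : R := 3 * Q x * Y2 x ^ 2.

Lemma source_opp (x : R) : source (- x) = source x.
Proof. unfold source, Q, Y2. now rewrite sech_opp. Qed.

Lemma source_bound (x : R) : 0 <= source x <= 3 * sqrt 2 * sech x.
Proof.
  assert (H1 := sech_pos x). assert (H2 := sech_le_1 x).
  assert (H3 : 0 < sqrt 2) by (apply sqrt_lt_R0; lra).
  assert (H4 : 0 <= Y2 x ^ 2 <= 1).
  { split; [apply pow2_ge_0 | ]. unfold Y2.
    assert (0 <= sech x ^ 2 <= 1) by nra. nra. }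
  replace (source x) with (3 * sqrt 2 * sech x * Y2 x ^ 2) by (unfold source, Q; ring).
  assert (0 < sqrt 2 * sech x) by (apply Rmult_lt_0_compat; lra).
  split; nra.
Qed.

Lemma ex_derive_source (x : R) : ex_derive source x.
Proof.
  unfold source, Q, Y2. auto_derive. repeat split; apply ex_derive_sech.
Qed.

Lemma continuous_jost_re_source (xi x : R) : continuous (fun y => jost_re xi y * source y) x.
Proof.
  apply (ex_derive_continuous (fun y => jost_re xi y * source y)).
  apply @ex_derive_mult; [ | apply ex_derive_source].
  eexists. apply is_derive_jost_re.
Qed.

Lemma continuous_jost_im_source (xi x : R) : continuous (fun y => jost_im xi y * source y) x.
Proof.
  apply (ex_derive_continuous (fun y => jost_im xi y * source y)).
  apply @ex_derive_mult; [ | apply ex_derive_source].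
  eexists. apply is_derive_jost_im.
Qed.

Lemma Rabs_jost_im_le (xi x : R) : Rabs (jost_im xi x) <= 4 + xi ^ 2 + 3 * Rabs xi.
Proof.
  unfold jost_im.
  assert (Hc := Rabs_cos_le_1 (xi * x)). assert (Hs := Rabs_sin_le_1 (xi * x)).
  assert (Ht := Rabs_tanh_le_1 x). assert (Hp := Rabs_pos xi). assert (Hx := pow2_ge_0 xi).
  assert (A1 : Rabs (3 * tanh x ^ 2 - 1 - xi ^ 2) <= 4 + xi ^ 2).
  { assert (E := tanh_sqr x). assert (H1 := sech_pos x). assert (H2 := pow2_ge_0 (tanh x)).
    apply Rabs_le_between. nra. }
  eapply Rle_trans; [apply Rabs_triang | ].
  rewrite Rabs_Ropp, 4!Rabs_mult, (Rabs_right 3) by lra.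
  assert (P1 := Rabs_pos (3 * tanh x ^ 2 - 1 - xi ^ 2)).
  assert (P2 := Rabs_pos (tanh x)).
  assert (P3 := Rabs_pos (cos (xi * x))). assert (P4 := Rabs_pos (sin (xi * x))).
  apply Rplus_le_compat; [nra | ].
  assert (Rabs (tanh x) * Rabs (cos (xi * x)) <= 1) by nra. nra.
Qed.

Lemma is_RInt_gen_jost_im_source (xi : R) :
  is_RInt_gen (fun x => jost_im xi x * source x) (Rbar_locally m_infty) (Rbar_locally p_infty) 0.
Proof.
  apply is_RInt_gen_odd with ((4 + xi ^ 2 + 3 * Rabs xi) * (3 * sqrt 2)).
  - apply continuous_jost_im_source.
  - intros x. assert (H1 := Rabs_jost_im_le xi x). assert (H2 := source_bound x).
    rewrite Rabs_mult, (Rabs_right (source x)), Rmult_assoc by lra.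
    apply Rmult_le_compat; [apply Rabs_pos | lra | lra | lra].
  - intros x. rewrite jost_im_opp, source_opp. ring.
Qed.

(* Found by repeated use of
   [(sech^n (tanh cos - (xi / n) sin))' = ((n + 1) sech^(n+2) - (n^2 + xi^2) / n sech^n) cos],
   where [sin] and [cos] are taken at [xi x], together with [(sech^n)' = - n sech^n tanh],
   for [xi^2 = 3]. *)
Definition source_primitive (x : R) : R :=
  sech x * (sqrt 3 * sin (sqrt 3 * x) * (- 3 / 4 + 21 / 8 * sech x ^ 2 - 9 / 8 * sech x ^ 4)
            + tanh x * cos (sqrt 3 * x) * (- 9 / 4 + 9 / 8 * sech x ^ 2 - 9 / 8 * sech x ^ 4)).

Lemma is_derive_source_primitive (x : R) :
  is_derive source_primitive x
    (jost_re (sqrt 3) x * (sech x * Y2 x ^ 2) + sech x * cos (sqrt 3 * x)).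
Proof.
  unfold source_primitive, jost_re, Y2. derive_sech_tanh.
  assert (E := tanh_sqr x). assert (E3 := sqrt3_sqr).
  set (q := sqrt 3) in *. set (t := tanh x) in *. set (s := sech x) in *.
  set (c := cos (q * x)). set (d := sin (q * x)).
  set (y := 1 - 3 / 2 * s ^ 2).
  apply Rminus_diag_uniq.
  transitivity
    ((q ^ 2 - 3) * (s * c * (- 3 / 4 + 21 / 8 * s ^ 2 - 9 / 8 * s ^ 4 + y ^ 2))
     + (t ^ 2 - (1 - s ^ 2)) * (- s * c * (- 9 / 4 + 9 / 8 * s ^ 2 - 9 / 8 * s ^ 4
        + (9 / 4 * s - 9 / 2 * s ^ 3) * s + 3 * y ^ 2))).
  - unfold y. field.
  - rewrite E, E3. ring.
Qed.

Lemma is_lim_source_primitive (p : Rbar) :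
  p = m_infty \/ p = p_infty -> is_lim source_primitive p 0.
Proof.
  intros Hp. apply is_lim_dominated_0 with sech (6 * sqrt 3 + 6); [ | now apply is_lim_sech].
  intros x. unfold source_primitive.
  assert (H1 := sech_pos x). assert (H2 := sech_le_1 x). assert (H3 := sqrt3_pos).
  rewrite Rabs_mult, Rmult_comm, (Rabs_right (sech x)) by lra.
  apply Rmult_le_compat_r; [lra | ].
  assert (Q2 : 0 <= sech x ^ 2 <= 1) by nra.
  assert (Q4 : 0 <= sech x ^ 4 <= 1) by (replace (sech x ^ 4) with (sech x ^ 2 * sech x ^ 2) by ring; nra).
  assert (A1 : Rabs (- 3 / 4 + 21 / 8 * sech x ^ 2 - 9 / 8 * sech x ^ 4) <= 6)
    by (apply Rabs_le_between; lra).
  assert (A2 : Rabs (- 9 / 4 + 9 / 8 * sech x ^ 2 - 9 / 8 * sech x ^ 4) <= 6)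
    by (apply Rabs_le_between; lra).
  assert (Hc := Rabs_cos_le_1 (sqrt 3 * x)). assert (Hs := Rabs_sin_le_1 (sqrt 3 * x)).
  assert (Ht := Rabs_tanh_le_1 x).
  eapply Rle_trans; [apply Rabs_triang | ].
  rewrite 4!Rabs_mult, (Rabs_right (sqrt 3)) by lra.
  assert (P2 := Rabs_pos (tanh x)).
  assert (P3 := Rabs_pos (cos (sqrt 3 * x))). assert (P4 := Rabs_pos (sin (sqrt 3 * x))).
  apply Rplus_le_compat.
  - rewrite (Rmult_comm 6). apply Rmult_le_compat; [nra | apply Rabs_pos | nra | easy].
  - rewrite <- (Rmult_1_l 6). apply Rmult_le_compat; [nra | apply Rabs_pos | nra | easy].
Qed.

Lemma is_RInt_gen_jost_re_source :
  is_RInt_gen (fun x => jost_re (sqrt 3) x * source x)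
    (Rbar_locally m_infty) (Rbar_locally p_infty)
    (- (3 * sqrt 2 * PI * sech (PI * sqrt 3 / 2))).
Proof.
  assert (I1 : is_RInt_gen
    (fun x => jost_re (sqrt 3) x * (sech x * Y2 x ^ 2) + sech x * cos (sqrt 3 * x))
    (Rbar_locally m_infty) (Rbar_locally p_infty) (0 - 0)).
  { apply is_RInt_gen_antiderivative with source_primitive.
    - apply is_derive_source_primitive.
    - intros x. apply (continuous_plus (V := R_NormedModule)); [ | apply continuous_sech_cos].
      apply continuous_ext with (fun y => / (3 * sqrt 2) * (jost_re (sqrt 3) y * source y)).
      + intros y.
        change (/ (3 * sqrt 2) * (jost_re (sqrt 3) y * source y)
                = jost_re (sqrt 3) y * (sech y * Y2 y ^ 2)).
        unfold source, Q. field. apply Rgt_not_eq, sqrt_lt_R0. lra.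
      + apply (continuous_scal_r (K := R_AbsRing) (V := R_NormedModule)).
        apply continuous_jost_re_source.
    - apply is_lim_source_primitive. now left.
    - apply is_lim_source_primitive. now right. }
  assert (I2 := is_RInt_gen_sech_cos (sqrt 3) (Rlt_le _ _ sqrt3_pos)).
  assert (I := is_RInt_gen_scal _ (3 * sqrt 2) _ (is_RInt_gen_minus _ _ _ _ I1 I2)).
  replace (- (3 * sqrt 2 * PI * sech (PI * sqrt 3 / 2))) with
    (scal (3 * sqrt 2) (minus (0 - 0) (PI * sech (PI * sqrt 3 / 2))))
    by (unfold scal, minus, plus, opp; simpl; unfold mult; simpl; ring).
  apply is_RInt_gen_ext with (2 := I).
  apply filter_forall. intros ab x _.
  unfold scal, minus, plus, opp; simpl; unfold mult; simpl. unfold source, Q. ring.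
Qed.

Lemma is_RInt_gen_lin (f g : R -> R) (Fa Fb : (R -> Prop) -> Prop)
    {FFa : Filter Fa} {FFb : Filter Fb} (a b lf lg : R) :
  is_RInt_gen f Fa Fb lf -> is_RInt_gen g Fa Fb lg ->
  is_RInt_gen (fun x => a * f x + b * g x) Fa Fb (a * lf + b * lg).
Proof.
  intros Hf Hg.
  exact (is_RInt_gen_plus _ _ _ _ (is_RInt_gen_scal _ a _ Hf) (is_RInt_gen_scal _ b _ Hg)).
Qed.

Lemma dFT_of_integrand (g : R -> C) (xi : R) (h : R -> C) (l : C) :
  (forall x, (Cconj (e x xi) * g x)%C = h x) ->
  is_RInt_gen (V := C_R_NormedModule) h (Rbar_locally m_infty) (Rbar_locally p_infty) l ->
  dFT_converges g xi /\ dFT g xi = l.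
Proof.
  intros E I. unfold dFT_converges, dFT.
  rewrite (functional_extensionality _ _ E). split; [now exists l | ].
  apply (is_RInt_gen_unique (V := C_R_CompleteNormedModule)). exact I.
Qed.

Lemma e_sqrt3 (x : R) :
  e x (sqrt 3) = (RtoC (/ sqrt (2 * PI)) * (transmission (sqrt 3) * jost (sqrt 3) x))%C.
Proof.
  assert (H3 := sqrt3_pos). unfold e. destruct Rle_dec as [_ | H]; [ | lra].
  rewrite T_eq, f_plus_eq by lra. ring.
Qed.

Lemma e_opp_sqrt3 (x : R) :
  e x (- sqrt 3) = (RtoC (/ sqrt (2 * PI)) * (transmission (sqrt 3) * jost (sqrt 3) (- x)))%C.
Proof.
  assert (H3 := sqrt3_pos). unfold e. destruct Rle_dec as [H | _]; [lra | ].
  rewrite Ropp_involutive, T_eq, f_minus_eq by lra. ring.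
Qed.

(* The part of the integral against [jost_im] vanishes, so its sign [b] is immaterial. *)
Lemma dFT_source_of_basis (xi b : R) :
  (forall x, e x xi = (RtoC (/ sqrt (2 * PI)) *
     (jost_coef1 (sqrt 3) * jost_re (sqrt 3) x + b * jost_coef2 (sqrt 3) * jost_im (sqrt 3) x,
      b * jost_coef1 (sqrt 3) * jost_im (sqrt 3) x - jost_coef2 (sqrt 3) * jost_re (sqrt 3) x)%R)%C) ->
  dFT_converges (fun x => RtoC (source x)) xi /\
  dFT (fun x => RtoC (source x)) xi =
    (RtoC (3 / 28) * (1 - 3 * Ci * RtoC (sqrt 3))
     * RtoC (sqrt PI) * RtoC (sech (PI * sqrt 3 / 2)))%C.
Proof.
  intros He.
  set (m := / sqrt (2 * PI)) in He.
  set (k1 := jost_coef1 (sqrt 3)) in He. set (k2 := jost_coef2 (sqrt 3)) in He.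
  assert (I := is_RInt_gen_C_pair _ _ _ _ _ _
    (is_RInt_gen_lin _ _ _ _ (m * k1) (m * b * k2) _ _ is_RInt_gen_jost_re_source
       (is_RInt_gen_jost_im_source (sqrt 3)))
    (is_RInt_gen_lin _ _ _ _ (m * k2) (- (m * b * k1)) _ _ is_RInt_gen_jost_re_source
       (is_RInt_gen_jost_im_source (sqrt 3)))).
  match type of I with is_RInt_gen _ _ _ ?l => set (L := l) in I end.
  replace (RtoC (3 / 28) * (1 - 3 * Ci * RtoC (sqrt 3))
     * RtoC (sqrt PI) * RtoC (sech (PI * sqrt 3 / 2)))%C with (L : C).
  - apply dFT_of_integrand with (2 := I).
    intros x. rewrite He. apply injective_projections; simpl; ring.
  - assert (E3 := sqrt3_sqr). assert (HPI := PI_RGT_0).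
    assert (Em : m * sqrt 2 * PI = sqrt PI).
    { unfold m. rewrite sqrt_mult by lra.
      assert (H2 : 0 < sqrt 2) by (apply sqrt_lt_R0; lra).
      assert (HP : 0 < sqrt PI) by (apply sqrt_lt_R0; lra).
      rewrite <- (sqrt_sqrt PI) at 2 by lra. field. lra. }
    assert (K1 : k1 = - / 28) by (unfold k1, jost_coef1, jost_norm2; rewrite E3; field).
    assert (K2 : k2 = 3 * sqrt 3 / 28) by (unfold k2, jost_coef2, jost_norm2; rewrite E3; field).
    unfold L. rewrite K1, K2, <- Em. apply injective_projections; simpl; field.
Qed.

Theorem lemma1p5 :
  let g : R -> C := fun x => RtoC (3 * Q x * Y2 x ^ 2) in
  let v : C := (RtoC (3 / 28) * (1 - 3 * Ci * RtoC (sqrt 3))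
                * RtoC (sqrt PI) * RtoC (sech (PI * sqrt 3 / 2)))%C in
  (dFT_converges g (sqrt 3) /\ dFT g (sqrt 3) = v) /\
  (dFT_converges g (- sqrt 3) /\ dFT g (- sqrt 3) = v) /\
  v <> RtoC 0.
Proof.
  intros g v. split; [ | split].
  - apply (dFT_source_of_basis (sqrt 3) 1). intros x.
    rewrite e_sqrt3, transmission_mul_jost. do 2 f_equal; ring.
  - apply (dFT_source_of_basis (- sqrt 3) (-1)). intros x.
    rewrite e_opp_sqrt3, transmission_mul_jost, jost_re_opp, jost_im_opp. do 2 f_equal; ring.
  - intros E. apply (f_equal Re) in E. unfold v in E. simpl in E.
    assert (H1 := sech_pos (PI * sqrt 3 / 2)).
    assert (H2 : 0 < sqrt PI) by (apply sqrt_lt_R0, PI_RGT_0).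
    assert (H3 : 0 < sqrt PI * sech (PI * sqrt 3 / 2)) by now apply Rmult_lt_0_compat.
    lra.
Qed.
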